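(* Let $a,c$ be real numbers with $0<a<1$ and $c\neq 0,-1,-2,\ldots$, and let $\mathcal F=(F_1,F_2)$ be a pair of finite sets of positive integers (not both empty), with $k=|F_1|+|F_2|$. The following conditions are equivalent. 1. The measure $$\rho_{a,c}^{\mathcal F}=\sum_{x=u_{\mathcal F}}^\infty\ \prod_{f\in F_1}(x-f-u_{\mathcal F})\prod_{f\in F_2}(x+c+f-u_{\mathcal F})\,\frac{a^{x-u_{\mathcal F}}\Gamma(x+c-u_{\mathcal F})}{(x-u_{\mathcal F})!}\,\delta_x$$ is positive. 2. $c$ and $\mathcal F$ are admissible. 3. $\Gamma(n+c+k)\,\Omega_{\mathcal F}^{a,c}(n)\,\Omega_{\mathcal F}^{a,c}(n+1)>0$ for all nonnegative integers $n$.
   Context: $\mathbb N=\{0,1,2,\ldots\}$; $(y)_j=y(y+1)\cdots(y+j-1)$, $(y)_0=1$; $\delta_x$ is the Dirac mass at $x$. A discrete measure is positive if all its masses are nonnegative. Meixner polynomials: for $a\ne 0,1$, $m_n^{a,c}(x)=\frac{a^n}{(1-a)^n}\sum_{j=0}^n a^{-j}\binom{x}{j}\binom{-x-c}{n-j}$. For a pair $\mathcal F=(F_1,F_2)$ of finite sets of positive integers, let $k_i=|F_i|$, $k=k_1+k_2$, and $u_{\mathcal F}=\sum_{f\in F_1}f+\sum_{f\in F_2}f-\binom{k_1+1}{2}-\binom{k_2}{2}$. $\Omega_{\mathcal F}^{a,c}(x)$ is the determinant of the $k\times k$ matrix with columns indexed by $j=0,1,\ldots,k-1$ whose rows are $\big(m_f^{a,c}(x+j)\big)_j$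 for $f\in F_1$ (increasing order), followed by $\big(m_f^{1/a,c}(x+j)/a^j\big)_j$ for $f\in F_2$ (increasing order). Admissibility: for $c\neq 0,-1,-2,\ldots$ put $\hat c=\max\{-[c],0\}$, where $[c]$ is the integral part (floor) of $c$. The number $c$ and the pair $\mathcal F$ are admissible if for all $x\in\mathbb N$ $$\frac{\prod_{f\in F_1}(x-f)\prod_{f\in F_2}(x+c+f)}{(x+c)_{\hat c}}\ge 0 .$$ *)

(* Defs.v *)
From HB Require Import structures.
From mathcomp Require Import all_boot all_order all_algebra finmap.
From mathcomp Require Import all_classical all_reals all_analysis.

Set Implicit Arguments.
Unset Strict Implicit.
Unset Printing Implicit Defensive.

Import Order.TTheory GRing.Theory Num.Theory.
Import numFieldNormedType.Exports.

Local Open Scope classical_set_scope.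
Local Open Scope ring_scope.

Section Functions.
Variable R : realType.
Implicit Types (a c x y : R) (n j : nat).

(* (y)_j = y (y + 1) ... (y + j - 1) *)
Definition pochhammer y j : R := \prod_(i < j) (y + i%:R).

(* x (x - 1) ... (x - j + 1) / j! for a real x *)
Definition rbinom x j : R := (\prod_(i < j) (x - i%:R)) / j`!%:R.

Definition hatc c : nat := `|Num.max (- Num.floor c) 0|%N.

Definition Gamma_integral x : R :=
  \int[@lebesgue_measure R]_(t in `]0, +oo[) (t `^ (x - 1) * expR (- t)).

(* For x different from 0, -1, -2, ... one has x + hatc x > 0, and iterating
   Gamma (x + 1) = x Gamma x extends Euler's integral to such x; the value at
   the poles is a dummy. *)
Definition Gamma x : R :=
  Gamma_integral (x + (hatc x)%:R) / pochhammer x (hatc x).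

Definition meixner a c n x : R :=
  a ^+ n / (1 - a) ^+ n *
  \sum_(j < n.+1) a ^- j * rbinom x j * rbinom (- x - c) (n - j).

End Functions.

Section DiscreteMeasures.
Variable R : realType.

(* \sum_(x >= u) w x * delta_x as a real-valued, possibly signed, set function
   on the line; \1_A x is the Dirac mass delta_x evaluated at A. *)
Definition discrete_measure (u : nat) (w : nat -> R) : set R -> R :=
  fun A => limn (fun n => \sum_(u <= x < n) w x * \1_A (x%:R : R)).

Definition positive_discrete (mu : set R -> R) : Prop :=
  forall y : R, 0 <= mu [set y].

End DiscreteMeasures.

Section Families.
Variables (R : realType) (F : {fset nat} * {fset nat}).
Implicit Types (a c : R).

(* For finite sets of positive integers the subtractions are not truncated. *)
Definition uF : nat :=
  (\sum_(f <- F.1) f + \sum_(f <- F.2) f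
   - 'C(#|` F.1|.+1, 2) - 'C(#|` F.2|, 2))%N.

Definition kF : nat := (#|` F.1| + #|` F.2|)%N.

(* The i-th smallest element of A, counting from 0. *)
Definition nth_elt (A : {fset nat}) (i : nat) : nat := nth 0%N (sort leq A) i.

Definition Omega a c (x : R) : R :=
  \det (col_mx
    (\matrix_(i < #|` F.1|, j < kF) meixner a c (nth_elt F.1 i) (x + j%:R))
    (\matrix_(i < #|` F.2|, j < kF)
        (meixner a^-1 c (nth_elt F.2 i) (x + j%:R) / a ^+ j))).

Definition admissible c : Prop :=
  forall x : nat,
    0 <= (\prod_(f <- F.1) (x%:R - f%:R) * \prod_(f <- F.2) (x%:R + c + f%:R))
         / pochhammer (x%:R + c) (hatc c).

Definition rho_mass a c (x : nat) : R :=
  \prod_(f <- F.1) (x%:R - f%:R - uF%:R) *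
  \prod_(f <- F.2) (x%:R + c + f%:R - uF%:R) *
  (a ^+ (x - uF) * Gamma (x%:R + c - uF%:R) / (x - uF)`!%:R).

Definition rho a c : set R -> R := discrete_measure uF (rho_mass a c).

End Families.

(* Main.v *)
Require Import Defs.
From HB Require Import structures.
From mathcomp Require Import all_boot all_order all_algebra finmap.
From mathcomp Require Import ring lra.
From mathcomp Require Import all_classical all_reals all_analysis measurable_realfun.

Set Implicit Arguments.
Unset Strict Implicit.
Unset Printing Implicit Defensive.

Import Order.TTheory GRing.Theory Num.Theory.
Import numFieldNormedType.Exports.

Local Open Scope ring_scope.

(* Let [w y = (c)_y a ^ y / y!] be the Meixner weight, [L] its moment functional,
   [p_n] the Meixner polynomials, [h_n = L (p_n ^ 2)], and let [P] have the simple
   zeros [f] for [f] in [F.1] and [- f - c] for [f] in [F.2]. With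
   [s = (c)_(hatc c)], the signs of the values of [Gamma] and of [(x + c)_(hatc c)]
   are those of [s (c)_n], so that the first two conditions both say that the
   function [s P w] is nonnegative on the natural numbers. This holds if and only
   if [s L (P q ^ 2) > 0] for all polynomials [q <> 0]: the masses decay
   geometrically and are therefore determined by the quadratic form. Christoffel's
   formula turns the latter into [s (-1) ^ k D_n D_(n+1) h_n > 0], where [D_n] is
   the determinant of the values of [p_n, ..., p_(n+k-1)] at the zeros of [P].
   Finally the duality between degree and variable of the Meixner polynomials,
   together with the reflection [a -> 1 / a], [x -> - x - c], identifies [D_n] with
   [Omega n] up to factors of known sign, and [h_n] has the sign of [(c)_n]. *)

(** * Rising factorials and their signs *)

Section Pochhammer.
Variable R : realType.
Implicit Types (c x : R) (m n : nat).

Lemma pochhammer0 c : pochhammer c 0 = 1.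
Proof. by rewrite /pochhammer big_ord0. Qed.

Lemma pochhammerS c n : pochhammer c n.+1 = pochhammer c n * (c + n%:R).
Proof. by rewrite /pochhammer big_ord_recr. Qed.

Lemma pochhammerD c m n :
  pochhammer c (m + n) = pochhammer c m * pochhammer (c + m%:R) n.
Proof.
elim: n => [|n IHn]; first by rewrite addn0 pochhammer0 mulr1.
by rewrite addnS !pochhammerS IHn natrD addrA mulrA.
Qed.

Lemma pochhammer_gt0 c n : 0 < c -> 0 < pochhammer c n.
Proof.
by move=> c0; apply: prodr_gt0 => i _; rewrite ltr_wpDr.
Qed.

Lemma pochhammer_neq0 c n :
  (forall m : nat, c <> - m%:R) -> pochhammer c n != 0.
Proof.
move=> hc; apply/prodf_neq0 => i _; rewrite addr_eq0; exact/eqP/hc.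
Qed.

(** For [m <= n], the factors of [(c)_n] beyond those of [(c)_m] start at [c + m > 0] and are
    positive, so the product is a nonzero square times a positive number. *)
Lemma pochhammer_sameside c m n :
  (forall m : nat, c <> - m%:R) -> 0 < c + m%:R -> 0 < c + n%:R ->
  0 < pochhammer c m * pochhammer c n.
Proof.
move=> hc; wlog le_mn : m n / (m <= n)%N => [hw|] hm hn.
  by case/orP: (leq_total m n) => h; last rewrite mulrC; exact: hw.
rewrite -(subnKC le_mn) pochhammerD mulrA -expr2 mulr_gt0 ?pochhammer_gt0//.
by rewrite exprn_even_gt0 // pochhammer_neq0.
Qed.

(** For negative [c] the sum is the fractional part of [c], which vanishes only at the excluded
    integers. *)
Lemma addr_hatc_gt0 c : (forall m : nat, c <> - m%:R) -> 0 < c + (hatc c)%:R.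
Proof.
move=> hc; rewrite /hatc natr_absz.
have -> : `|Num.max (- Num.floor c) 0| = Num.max (- Num.floor c) 0.
  by apply: ger0_norm; rewrite le_max lexx orbT.
have [lt0|ge0] := ltP (Num.floor c) 0.
  rewrite max_l ?oppr_ge0 ?ltW// rmorphN /= subr_gt0 lt_neqAle floor_le_tmp.
  have [c_floor|//] := eqVneq (Num.floor c)%:~R c.
  case: (hc `|Num.floor c|%N).
  by rewrite natr_absz ltr0_norm// rmorphN /= opprK c_floor.
rewrite max_r ?oppr_le0// addr0 lt_neqAle eq_sym.
have /eqP -> /= : c <> 0 by have := hc 0%N; rewrite oppr0.
by rewrite -floor_ge0.
Qed.

End Pochhammer.

(** * Finiteness and positivity of Euler's integral *)

Section GammaIntegral.
Variable R : realType.
Local Open Scope classical_set_scope.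
Implicit Types x t : R.

Let mu := @lebesgue_measure R.
Let integrand x t : R := t `^ (x - 1) * expR (- t).

Let measurable_integrand x (D : set R) :
  measurable D -> measurable_fun D (integrand x).
Proof.
move=> mD; apply: measurable_funM.
  by apply: measurable_funTS; exact: measurable_powR.
apply: measurable_funTS; apply: measurableT_comp => //.
Qed.

Let integrand_ge0 x t : 0 <= integrand x t.
Proof. by rewrite mulr_ge0 ?powR_ge0 ?expR_ge0. Qed.

(** Raise [u <= expR u] at [u = t / (2 * x)] to the power [x]. *)
Lemma powR_le_expR x t : 0 < x -> 0 < t ->
  t `^ x <= (2 * x) `^ x * expR (t / 2).
Proof.
move=> x0 t0; have x2 : 0 < 2 * x by rewrite mulr_gt0.
rewrite [t in leLHS](_ : t = 2 * x * (t / (2 * x))); last first.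
  by rewrite mulrCA divff ?gt_eqF// mulr1.
rewrite powRM; [|exact: ltW|by rewrite ltW ?divr_gt0].
rewrite ler_pM2l ?powR_gt0//.
rewrite (_ : t / 2 = t / (2 * x) * x); last by field; rewrite gt_eqF.
rewrite expRM ge0_ler_powR ?nnegrE ?(ltW x0) ?expR_ge0 ?divr_ge0 ?ltW//.
by rewrite (lt_le_trans _ (expR_ge1Dx _))// ltrDr.
Qed.

(* The function [- K / (1 + t ^ x)] is bounded on the half-line and its
   derivative [K x t ^ (x - 1) / (1 + t ^ x) ^ 2] dominates the integrand. *)
Lemma gamma_integrand_le x t : 0 < x -> 0 < t ->
  integrand x t <= (1 + (2 * x) `^ x) ^+ 2 * t `^ (x - 1) / (1 + t `^ x) ^+ 2.
Proof.
move=> x0 t0; rewrite /integrand (mulrC (_ ^+ 2)) -[leRHS]mulrA.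
rewrite ler_pM2l ?powR_gt0//.
have tx : 0 < 1 + t `^ x by rewrite ltr_wpDr ?powR_ge0.
rewrite ler_pdivlMr ?exprn_gt0// mulrC expRN ler_pdivrMr ?expR_gt0//.
(* Writing [expR t] as the square of [expR (t / 2)] makes both sides squares, and [powR_le_expR]
   compares their bases. *)
rewrite [t in expR t](_ : t = t / 2 * 2%:R); last by field.
rewrite expRM_natr -exprMn ler_pXn2r ?nnegrE ?mulr_ge0 ?addr_ge0 ?powR_ge0 ?expR_ge0//.
rewrite mulrDl lerD//; last exact: powR_le_expR.
by rewrite mul1r -expR0 ler_expR divr_ge0 ?ltW.
Qed.

Let is_derive_bound x t (K : R) : 0 < t ->
  is_derive t 1 (fun t => - K * (1 + t `^ x)^-1)
    (K * x * t `^ (x - 1) / (1 + t `^ x) ^+ 2).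
Proof.
move=> t0; have tx : 1 + t `^ x != 0 by rewrite gt_eqF// ltr_wpDr ?powR_ge0.
have h1 : is_derive t 1 (fun t => 1 + t `^ x) (x * t `^ (x - 1)).
  rewrite -[X in is_derive _ _ _ X]add0r.
  by apply: is_deriveD; exact: is_derive1_powR.
have h2 := @is_deriveV R (fun t => 1 + t `^ x) t _ 1 tx h1.
apply: (is_derive_eq (@is_deriveZ _ _ _ _ (- K) _ _ _ h2)).
by rewrite /GRing.scale /=; field.
Qed.

Let continuous_powR (y t : R) : 0 < t -> {for t, continuous (fun u : R => u `^ y)}.
Proof.
move=> t0; apply/differentiable_continuous/derivable1_diffP.
by apply: derivable_powR; rewrite in_itv/= t0.
Qed.

Let continuous_bound x t (K : R) : 0 < t ->
  {for t, continuous (fun t => K * x * t `^ (x - 1) / (1 + t `^ x) ^+ 2)}.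
Proof.
move=> t0; apply: continuousM.
  by apply: continuousM; [exact: cst_continuous|exact: continuous_powR].
apply: continuousV; first by rewrite expf_neq0// gt_eqF// ltr_wpDr ?powR_ge0.
apply: (@continuousM _ _ (fun t => 1 + t `^ x) (fun t => 1 + t `^ x));
by apply: continuousD; [exact: cst_continuous|exact: continuous_powR].
Qed.

(** The antiderivative of the majorant takes its values between [- K] and [0], whence a bound
    independent of [m] and [n]. *)
Lemma integral_gamma_integrand_le x (m n : R) : 0 < x -> 0 < m -> m < n ->
  (\int[mu]_(t in `[m, n]) (integrand x t)%:E <=
   ((1 + (2 * x) `^ x) ^+ 2 / x)%:E)%E.
Proof.
move=> x0 m0 mn; set K := _ / x.
pose g t := K * x * t `^ (x - 1) / (1 + t `^ x) ^+ 2.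
pose G t := - K * (1 + t `^ x)^-1.
have Gg t : 0 < t -> is_derive t 1 G (g t) by exact: is_derive_bound.
have K0 : 0 <= K by rewrite divr_ge0 ?exprn_even_ge0 ?ltW.
have cg : {within `[m, n], continuous g}.
  apply: continuous_in_subspaceT => t; rewrite inE/= in_itv/= => /andP[mt _].
  exact/continuous_bound/(lt_le_trans m0 mt).
have cG (t : R) : 0 < t -> {for t, continuous G}.
  by move=> t0; apply/differentiable_continuous/derivable1_diffP; case: (Gg _ t0).
have mI : measurable (`[m, n] : set R) by [].
apply: (@le_trans _ _ (\int[mu]_(t in `[m, n]) (g t)%:E)%E).
  apply: ge0_le_integral => //.
  - by move=> t _; rewrite lee_fin.
  - by apply/measurable_EFinP; exact: measurable_integrand.
  - by apply/measurable_EFinP; exact: subspace_continuous_measurable_fun.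
  - move=> t; rewrite /= in_itv/= => /andP[mt _]; rewrite lee_fin.
    have gK : g t = (1 + (2 * x) `^ x) ^+ 2 * t `^ (x - 1) / (1 + t `^ x) ^+ 2.
      by rewrite /g /K divfK // gt_eqF.
    rewrite gK; exact: gamma_integrand_le x0 (lt_le_trans m0 mt).
rewrite (continuous_FTC2 mn cg (F := G)); last 2 first.
  split.
  - move=> t; rewrite in_itv/= => /andP[mt _].
    by case: (Gg _ (lt_trans m0 mt)).
  - by apply: cvg_at_right_filter; exact: cG.
  - by apply/cvg_at_left_filter/cG; exact: lt_trans mn.
- move=> t; rewrite in_itv/= => /andP[mt _].
  by rewrite derive1E; case: (Gg _ (lt_trans m0 mt)).
have G_lt0 t : 0 < (1 + t `^ x)^-1 <= 1.
  by rewrite invr_gt0 ltr_wpDr ?powR_ge0// invf_le1 ?lerDl ?ltr_wpDr ?powR_ge0.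
rewrite -EFinB lee_fin /G !mulNr opprK addrC.
have /andP[n0 _] := G_lt0 n; have /andP[_ m1] := G_lt0 m.
apply: (@le_trans _ _ (K / (1 + m `^ x))); last exact: ler_piMr.
by rewrite gerDl oppr_le0 mulr_ge0// ltW.
Qed.

(** Monotone convergence along an exhaustion of the half-line. Finiteness matters for positivity,
    because the real-valued integral takes the dummy value 0 when the extended one is infinite. *)
Lemma integral_gamma_integrand_lt_pinfty x : 0 < x ->
  (\int[mu]_(t in `]0%R, +oo[) (integrand x t)%:E < +oo)%E.
Proof.
(* Starting at 2 keeps the left endpoint strictly below the right one. *)
move=> x0; pose I n : set R := `[n.+2%:R^-1, n.+2%:R].
have n_gt0 n : 0 < n.+2%:R :> R by rewrite ltr0n.
have -> : `]0%R, +oo[%classic = \bigcup_n I n.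
  apply/seteqP; split=> [t|t [n _]]; rewrite /I /= !in_itv/= ?andbT; last first.
    by move=> /andP[tn _]; rewrite (lt_le_trans _ tn)// invr_gt0.
  move=> t0.
    have [n [n1 n2]] : exists n, n.+2%:R^-1 <= t /\ t <= n.+2%:R.
      have h : 0 <= t + t^-1 by rewrite addr_ge0 ?invr_ge0 ?(ltW t0).
      (* An index beyond [t + 1 / t] serves both endpoints. *)
      exists (Num.truncn (t + t^-1)).
      have {h} := truncnS_gt (t + t^-1).
      set N := Num.truncn _ => h.
      have hN : t + t^-1 <= N.+2%:R by rewrite (le_trans (ltW h))// ler_nat.
      have tV : 0 < t^-1 by rewrite invr_gt0.
      split; last by rewrite (le_trans _ hN)// lerDl ltW.
      rewrite -[t]invrK lef_pV2 ?posrE//.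
      by rewrite (le_trans _ hN)// lerDr ltW.
    by exists n => //=; rewrite in_itv/= n1 n2.
have ndI : nondecreasing_seq I.
  move=> i j ij; rewrite subsetEset => t; rewrite /I /= !in_itv/= => /andP[t1 t2].
  rewrite (le_trans t2) ?ler_nat// andbT (le_trans _ t1)// lef_pV2 ?posrE//.
  by rewrite ler_nat.
have mI i : measurable (I i) by exact: measurable_itv.
have mf i : measurable_fun (I i) (EFin \o integrand x).
  by apply/measurable_EFinP; exact: measurable_integrand.
have f0 i t : I i t -> (0 <= (EFin \o integrand x) t)%E.
  by move=> _; rewrite lee_fin.
have cvgI := @ge0_nondecreasing_set_cvg_integral _ (measurableTypeR R) R I
  (EFin \o integrand x) lebesgue_measure ndI mI mf f0.
rewrite -(cvg_lim _ cvgI) //.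
apply: (@le_lt_trans _ _ ((1 + (2 * x) `^ x) ^+ 2 / x)%:E); last by rewrite ltry.
apply: lime_le; first exact: (cvgP _ cvgI).
apply: nearW => n; apply: integral_gamma_integrand_le; rewrite ?invr_gt0//.
by rewrite (@lt_trans _ _ 1)// ?invf_lt1 ?ltr1n.
Qed.

Lemma Gamma_integral_gt0 x : 0 < x -> 0 < Gamma_integral x.
Proof.
(* On [[1, 2]], an interval of length 1, the integrand is [expR ((x - 1) * ln t - t)] with
   [0 <= ln t <= 1] and [t <= 2], hence at least [d]. *)
move=> x0; pose d := expR (- `|x - 1| - 2).
have d0 : 0 < d by exact: expR_gt0.
have dle t : 1 <= t <= 2 -> d <= integrand x t.
  move=> /andP[t1 t2]; have t0 : 0 < t by exact: lt_le_trans t1.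
  rewrite /integrand /powR gt_eqF// -expRD ler_expR.
  have l0 : 0 <= ln t by exact: ln_ge0.
  have l1 : ln t <= 1.
    have := @le_ln1Dx R (t - 1); rewrite ltrBrDr addNr t0 => /(_ isT).
    by rewrite addrC subrK => /le_trans -> //; lra.
  have : - ((x - 1) * ln t) <= `|x - 1|.
    apply: (le_trans (ler_norm _)); rewrite normrN normrM ler_piMr//.
    by rewrite ger0_norm.
  by lra.
suff h : (d%:E <= \int[mu]_(t in `]0%R, +oo[) (integrand x t)%:E)%E.
  have := integral_gamma_integrand_lt_pinfty x0.
  rewrite /Gamma_integral /Rintegral; case: integral h => //= r.
  by rewrite lee_fin => /(lt_le_trans d0).
apply: (@le_trans _ _ (\int[mu]_(t in `[1%R, 2%R]) (integrand x t)%:E)%E).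
  have <- : (\int[mu]_(t in `[1%R, 2%R]) (cst d%:E) t = d%:E)%E.
    rewrite integral_cst//= /mu lebesgue_measure_itv/= lte_fin ltr1n.
    by rewrite -EFinB -EFinM; congr EFin; lra.
  apply: ge0_le_integral => //.
  - by move=> t _; rewrite lee_fin ltW.
  - by apply/measurable_EFinP; exact: measurable_integrand.
apply: ge0_subset_integral => //.
- by apply/measurable_EFinP; exact: measurable_integrand.
- by move=> t _; rewrite lee_fin.
- by move=> t /=; rewrite !in_itv/= andbT => /andP[t1 _]; exact: lt_le_trans t1.
Qed.

End GammaIntegral.

(** * The signs of Gamma and of the admissibility denominator *)

Section GammaSign.
Variable R : realType.
Implicit Types (c : R) (n : nat).

(** [Gamma (c + n)] is a positive integral divided by [(c + n)_h = (c)_(n + h) / (c)_n], and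
    [(c)_(n + h)] has the sign of [(c)_(hatc c)] by [pochhammer_sameside]. *)
Lemma Gamma_sign c n : (forall m : nat, c <> - m%:R) ->
  exists2 d, 0 < d & Gamma (c + n%:R) =
    d * (pochhammer c (hatc c) * pochhammer c n).
Proof.
move=> hc; have hcn m : c + n%:R <> - m%:R.
  by move=> /eqP; rewrite eq_sym -subr_eq -opprD -natrD eq_sym => /eqP; exact: hc.
rewrite /Gamma; set h := hatc (c + _).
have h0 : 0 < c + n%:R + h%:R by exact: addr_hatc_gt0.
have G0 := Gamma_integral_gt0 h0.
have nz m : pochhammer c m != 0 by exact: pochhammer_neq0.
have pnh := pochhammerD c n h.
have nzh : pochhammer (c + n%:R) h != 0 by exact: pochhammer_neq0.
have p0 : 0 < pochhammer c (n + h) * pochhammer c (hatc c).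
  by apply: pochhammer_sameside; rewrite ?natrD ?addrA ?addr_hatc_gt0.
exists (Gamma_integral (c + n%:R + h%:R) /
  (pochhammer c (n + h) * pochhammer c (hatc c))).
  exact: divr_gt0.
by rewrite pnh; field; rewrite ?nz ?nzh.
Qed.

(** The quotient [(c)_n / (c)_(n + h)] appears again, so the denominator in [admissible] has the
    same sign as [Gamma (c + n)]. *)
Lemma pochhammer_hatc_sign c n : (forall m : nat, c <> - m%:R) ->
  exists2 d, 0 < d & (pochhammer (n%:R + c) (hatc c))^-1 =
    d * (pochhammer c (hatc c) * pochhammer c n).
Proof.
move=> hc; set h := hatc c; rewrite addrC.
have nz m : pochhammer c m != 0 by exact: pochhammer_neq0.
have pnh := pochhammerD c n h.
have nzh : pochhammer (c + n%:R) h != 0.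
  by have := nz (n + h)%N; rewrite pnh mulf_eq0 negb_or => /andP[].
have p0 : 0 < pochhammer c (n + h) * pochhammer c h.
  apply: pochhammer_sameside; rewrite ?addr_hatc_gt0//.
  by rewrite natrD addrCA ltr_wpDl ?addr_hatc_gt0.
exists (pochhammer c (n + h) * pochhammer c h)^-1; first by rewrite invr_gt0.
by rewrite pnh; field; rewrite ?nzh ?nz.
Qed.

End GammaSign.

(** * Masses of a discrete measure *)

Section PositiveDiscrete.
Variable R : realType.
Local Open Scope classical_set_scope.
Implicit Types (u n : nat) (w : nat -> R).

Lemma discrete_measure_nat u w n : (u <= n)%N ->
  discrete_measure u w [set n%:R] = w n.
Proof.
move=> un; apply: cvg_lim => //; apply: cvg_near_cst.
near=> N; have nN : (n < N)%N by near: N; exact: nbhs_infty_gt.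
rewrite (@big_cat_nat _ _ _ n) ?(ltnW nN)//= big_nat_cond big1 ?add0r; last first.
  move=> i /andP[/andP[_ lt_in] _]; rewrite indicE memNset ?mulr0//=.
  by move/eqP; rewrite eqr_nat ltn_eqF.
rewrite big_ltn// indicE mem_set//= mulr1 big_nat_cond big1 ?addr0// => i.
move=> /andP[/andP[lt_ni _] _]; rewrite indicE memNset ?mulr0//=.
by move/eqP; rewrite eqr_nat gtn_eqF.
Unshelve. all: by end_near. Qed.

Lemma discrete_measure_notin u w (y : R) : (forall n, (u <= n)%N -> y <> n%:R) ->
  discrete_measure u w [set y] = 0.
Proof.
move=> y_notin; apply: cvg_lim => //; apply: cvg_near_cst; near=> N.
rewrite big_nat_cond big1// => i /andP[/andP[ui _] _].
by rewrite indicE memNset ?mulr0//= => iy; apply: (y_notin i).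
Unshelve. all: by end_near. Qed.

Lemma positive_discreteP u w :
  positive_discrete (discrete_measure u w) <-> (forall n, 0 <= w (u + n)%N).
Proof.
split=> [pos n|pos y].
  by rewrite -(discrete_measure_nat w (leq_addr n u)); exact: pos.
have [[n [un ->]]|noty] := pselect (exists n, (u <= n)%N /\ y = n%:R).
  by rewrite discrete_measure_nat// -(subnKC un).
rewrite discrete_measure_notin// => n un yn; apply: noty; by exists n.
Qed.

End PositiveDiscrete.

(** * The zeros of the modifying polynomial and the first two conditions *)

Section Nodes.
Variables (R : realType) (F : {fset nat} * {fset nat}) (c : R).

(** The enumeration follows the order of the rows of [Omega], so that the determinants can be
    compared entry by entry. *)
Definition node (i : 'I_(kF F)) : R :=
  match fintype.split i with
  | inl i1 => (nth_elt F.1 i1)%:R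
  | inr i2 => - (nth_elt F.2 i2)%:R - c
  end.

Lemma big_nth_elt (A : {fset nat}) (g : nat -> R) :
  \prod_(i < #|` A|) g (nth_elt A i) = \prod_(f <- A) g f.
Proof.
have psA : perm_eq A (sort leq A) by rewrite perm_sym perm_sort.
by rewrite (perm_big _ psA)/= (big_nth 0%N) big_mkord size_sort.
Qed.

Lemma prod_subr_node x : \prod_i (x - node i) =
  \prod_(f <- F.1) (x - f%:R) * \prod_(f <- F.2) (x + c + f%:R).
Proof.
rewrite big_split_ord /= -!big_nth_elt; congr (_ * _); apply: eq_bigr => i _.
  rewrite /node; case: fintype.splitP => [j|j] /= ij.
    by rewrite ij.
  by have := ltn_ord i; rewrite ij ltnNge leq_addr.
rewrite /node; case: fintype.splitP => [j|j] /= ij.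
  by have := ltn_ord j; rewrite -ij ltnNge leq_addr.
by move/addnI: ij => ->; ring.
Qed.

Lemma nth_elt_inj (A : {fset nat}) i j : (i < #|` A|)%N -> (j < #|` A|)%N ->
  nth_elt A i = nth_elt A j -> i = j.
Proof.
move=> iA jA /eqP; rewrite nth_uniq ?size_sort// ?sort_uniq ?fset_uniq//.
by move/eqP.
Qed.

(** A coincidence between the two kinds of nodes would give [c = - (f + g)] with natural [f] and
    [g]. *)
Lemma node_inj : (forall m : nat, c <> - m%:R) -> injective node.
Proof.
move=> hc i j; rewrite /node.
case: (fintype.splitP i) => i' i'E; case: (fintype.splitP j) => j' j'E.
- move/eqP; rewrite eqr_nat => /eqP /nth_elt_inj ij; apply/val_inj.
  by rewrite /= i'E j'E ij.
- move=> h; case: (hc (nth_elt F.1 i' + nth_elt F.2 j')%N).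
  by rewrite natrD h; ring.
- move=> h; case: (hc (nth_elt F.2 i' + nth_elt F.1 j')%N).
  by rewrite natrD -h; ring.
- move/addIr/oppr_inj/eqP; rewrite eqr_nat => /eqP /nth_elt_inj ij; apply/val_inj.
  by rewrite /= i'E j'E ij.
Qed.

Hypothesis hc : forall m : nat, c <> - m%:R.

Definition sign_weight n : R := pochhammer c (hatc c) * pochhammer c n.

Lemma admissibleP : admissible F c <->
  forall n : nat, 0 <= sign_weight n * \prod_i (n%:R - node i).
Proof.
have eqv (n : nat) : (0 <= (\prod_(f <- F.1) (n%:R - f%:R) *
    \prod_(f <- F.2) (n%:R + c + f%:R)) / pochhammer (n%:R + c) (hatc c)) =
    (0 <= sign_weight n * \prod_i (n%:R - node i)).
  have [d d0 ->] := pochhammer_hatc_sign n hc.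
  by rewrite -prod_subr_node mulrC -mulrA pmulr_rge0.
by split=> adm n; [rewrite -eqv|rewrite eqv]; exact: adm.
Qed.

(** Reindexing by [x = uF + n] cancels the shift in every factor; [Gamma_sign] gives the sign of the
    Gamma factor, and what remains besides the product over the nodes is positive. *)
Lemma positive_rhoP (a : R) : 0 < a -> positive_discrete (rho F a c) <->
  forall n : nat, 0 <= sign_weight n * \prod_i (n%:R - node i).
Proof.
move=> a0; have eqv (n : nat) : (0 <= rho_mass F a c (uF F + n)) =
    (0 <= sign_weight n * \prod_i (n%:R - node i)).
  have [d d0 Gd] := Gamma_sign n hc.
  rewrite /rho_mass addKn.
  have -> : (uF F + n)%:R + c - (uF F)%:R = c + n%:R by rewrite natrD; ring.
  rewrite {}Gd (eq_bigr (fun f => n%:R - f%:R)); last by move=> f _; rewrite natrD; ring.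
  rewrite [X in _ * X * _](eq_bigr (fun f => n%:R + c + f%:R)); last first.
    by move=> f _; rewrite natrD; ring.
  rewrite -prod_subr_node -/(sign_weight n).
  have r (P A D S V : R) : P * (A * (D * S) * V) = A * D * V * (S * P) by ring.
  rewrite r.
  by rewrite pmulr_rge0// divr_gt0 ?mulr_gt0 ?exprn_gt0// ltr0n fact_gt0.
by split=> [/positive_discreteP|] pos; [|apply/positive_discreteP];
  move=> n; have := pos n; rewrite eqv.
Qed.

End Nodes.

(** * Binomial polynomials *)

Section BinomialPolynomials.
Variable R : realType.
Implicit Types (x t : R) (j n y : nat).

Definition binomp j : {poly R} := j`!%:R^-1 *: \prod_(i < j) ('X - i%:R%:P).

Lemma horner_binomp j x : (binomp j).[x] = rbinom x j.
Proof.
rewrite hornerZ horner_prod mulrC; congr (_ / _).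
by apply: eq_bigr => i _; rewrite hornerXsubC.
Qed.

Lemma size_binomp j : size (binomp j) = j.+1.
Proof.
rewrite size_scale ?invr_eq0 ?pnatr_eq0 -?lt0n ?fact_gt0//.
rewrite -(big_mkord xpredT (fun i => 'X - i%:R%:P)) size_prod_XsubC.
by rewrite size_iota subn0.
Qed.

Lemma rbinom0 x : rbinom x 0 = 1.
Proof. by rewrite /rbinom big_ord0 fact0 divr1. Qed.

Lemma natr_fact_neq0 j : j`!%:R != 0 :> R.
Proof. by rewrite pnatr_eq0 -lt0n fact_gt0. Qed.

Lemma rbinomS x j : rbinom x j.+1 = rbinom x j * (x - j%:R) / j.+1%:R.
Proof.
rewrite /rbinom big_ord_recr /= factS natrM.
have j0 := natr_fact_neq0 j; have : j.+1%:R != 0 :> R by rewrite pnatr_eq0.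
move: (_`!%:R) j0 (j.+1%:R) => u u0 v v0; move: (\prod_(_ < _) _) => p.
by field; rewrite u0 v0.
Qed.

Lemma rbinom_nat y j : rbinom (y%:R : R) j = 'C(y, j)%:R.
Proof.
elim: j => [|j IHj]; first by rewrite rbinom0 bin0.
rewrite rbinomS IHj; apply: (canLR (mulfK _)); first by rewrite pnatr_eq0.
have [jy|yj] := leqP j y; last by rewrite !bin_small ?mul0r// ltnW.
by rewrite -natrB// -!natrM mulnC -mul_bin_left mulnC.
Qed.

Lemma sum_binomial t y n : (y < n)%N ->
  \sum_(j < n) t ^+ j * 'C(y, j)%:R = (1 + t) ^+ y.
Proof.
move=> yn; rewrite exprDn -(subnKC yn) big_split_ord /= [X in _ + X]big1 ?addr0.
  by apply: eq_bigr => i _; rewrite expr1n mul1r mulr_natr.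
by move=> i _; rewrite bin_small ?mulr0// addSn ltnS leq_addr.
Qed.

Lemma sum_binomial_le t y n : 0 <= t ->
  \sum_(j < n) t ^+ j * 'C(y, j)%:R <= (1 + t) ^+ y.
Proof.
move=> t0; rewrite -(@sum_binomial _ _ (n + y.+1)) ?addnS ?ltnS ?leq_addl//.
rewrite -addnS big_split_ord /= lerDl sumr_ge0// => i _.
by rewrite mulr_ge0 ?exprn_ge0.
Qed.

End BinomialPolynomials.

(** * Series with geometric decay *)

Section GeometricSeries.
Variable R : realType.
Implicit Types (v w : nat -> R) (C r t : R) (q : {poly R}).
Local Open Scope classical_set_scope.

Definition tsum v : R := limn (series v).

Definition geometric_bound v C r := forall y, `|v y| <= C * r ^+ y.

(** A class of absolutely summable sequences with explicit tails that is stable under multiplication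
    by polynomials. *)
Definition geometric_decay v :=
  exists C r, [/\ 0 < r, r < 1 & geometric_bound v C r].

Lemma geometric_bound_cvg v C r : 0 <= r < 1 -> geometric_bound v C r ->
  cvgn (series v).
Proof.
move=> /andP[r0 r1] vC; apply: normed_cvg.
apply: (@series_le_cvg _ _ (geometric C r)).
- by move=> n /=.
- by move=> n; apply: le_trans (vC n).
- exact: vC.
- by apply: is_cvg_geometric_series; rewrite ger0_norm.
Qed.

Let series_ord v n : series v n = \sum_(i < n) v i.
Proof. by rewrite seriesEord. Qed.

Lemma tsum_tail v C r n : 0 <= r < 1 -> geometric_bound v C r ->
  `|tsum v - \sum_(i < n) v i| <= C * r ^+ n / (1 - r).
Proof.
move=> r01 vC; have /andP[r0 r1] := r01; have r'0 : 1 - r != 0 by lra.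
have C0 : 0 <= C by have := vC 0%N; rewrite expr0 mulr1; apply: le_trans.
(* The factor [1 - r ^+ k] lets the induction on [k] close; it is bounded by 1 at the end. *)
have part k : `|series v (n + k)%N - \sum_(i < n) v i| <=
    C * r ^+ n * (1 - r ^+ k) / (1 - r).
  rewrite !series_ord; elim: k => [|k IHk].
    by rewrite addn0 subrr normr0 expr0 subrr mulr0 mul0r.
  rewrite addnS big_ord_recr /= addrAC (le_trans (ler_normD _ _))//.
  apply: (le_trans (lerD IHk (vC _))).
  rewrite exprS exprD le_eqVlt; apply/orP; left; apply/eqP.
  move: (r ^+ n) (r ^+ k) => x y; by field.
have cv := geometric_bound_cvg r01 vC.
have cv' : `|series v (n + k)%N - \sum_(i < n) v i| @[k --> \oo] -->
    `|tsum v - \sum_(i < n) v i|.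
  apply: cvg_norm; apply: cvgB; last exact: cvg_cst.
  have cvs : series v (k + n)%N @[k --> \oo] --> tsum v.
    by rewrite (cvg_shiftn n (series v)); exact: cv.
  by under eq_fun do rewrite addnC; exact: cvs.
rewrite -(cvg_lim _ cv')//; apply: limr_le; first exact: cvgP cv'.
apply: nearW => k; apply: (le_trans (part k)).
rewrite ler_pM2r ?invr_gt0 ?subr_gt0// ler_piMr ?mulr_ge0 ?exprn_ge0//.
by rewrite gerBl exprn_ge0.
Qed.

Lemma geometric_decay_cvg v : geometric_decay v -> cvgn (series v).
Proof. by move=> [C [r [r0 r1]]]; apply: geometric_bound_cvg; rewrite ltW. Qed.

Lemma tsumD v w : geometric_decay v -> geometric_decay w ->
  tsum (fun y => v y + w y) = tsum v + tsum w.
Proof.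
by move=> /geometric_decay_cvg cv /geometric_decay_cvg cw; rewrite -lim_seriesD.
Qed.

Lemma tsumZ k v : geometric_decay v -> tsum (fun y => k * v y) = k * tsum v.
Proof. by move=> /geometric_decay_cvg cv; rewrite -[RHS]lim_seriesZ. Qed.

Lemma tsum_ge_term v m : geometric_decay v -> (forall y, 0 <= v y) ->
  v m <= tsum v.
Proof.
move=> /geometric_decay_cvg cv v0; apply: limr_ge => //.
near=> n; have mn : (m < n)%N by near: n; exact: nbhs_infty_gt.
by rewrite series_ord (bigD1 (Ordinal mn))//= lerDl sumr_ge0.
Unshelve. all: by end_near. Qed.

(** In the Horner step [t ^ y] is split as [s ^ y * s ^ y] with [s] the square root of [t]: one
    factor bounds the shorter polynomial, the other bounds [y] by Bernoulli's inequality. *)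
Lemma poly_le_geometric q t : 1 < t ->
  exists K, forall y : nat, `|q.[y%:R]| <= K * t ^+ y.
Proof.
elim/poly_ind: q t => [|q k IHq] t t1.
  by exists 0 => y; rewrite horner0 normr0 mul0r.
have t0 : 0 < t by lra.
pose s := Num.sqrt t.
have s2 : s ^+ 2 = t by rewrite sqr_sqrtr// ltW.
have s1 : 1 < s by rewrite -sqrtr1 ltr_sqrt.
have [K HK] := IHq _ s1.
have K0 : 0 <= K by have := HK 0%N; rewrite expr0 mulr1; apply: le_trans.
have bern y : y%:R <= s ^+ y / (s - 1).
  rewrite ler_pdivlMr ?subr_gt0//.
  elim: y => [|y IHy]; first by rewrite mul0r.
  rewrite -natr1 mulrDl mul1r exprS.
  have : 1 <= s ^+ y by rewrite exprn_ege1// ltW.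
  by nra.
exists (K / (s - 1) + `|k|) => y.
rewrite hornerMXaddC (le_trans (ler_normD _ _))// mulrDl lerD//; last first.
  by rewrite ler_peMr// exprn_ege1// ltW.
have -> : K / (s - 1) * t ^+ y = (K * s ^+ y) * (s ^+ y / (s - 1)).
  by rewrite -s2 expr2 exprMn; ring.
by rewrite normrM ler_pM// ger0_norm.
Qed.

(** The polynomial is bounded by powers of [(1 + r) / 2 / r > 1], which degrades the rate [r] only
    to [(1 + r) / 2 < 1]. *)
Lemma geometric_decayMp q v : geometric_decay v ->
  geometric_decay (fun y => v y * q.[y%:R]).
Proof.
move=> [C [r [r0 r1 vC]]].
have sr : r < (1 + r) / 2 by lra.
have [K HK] : exists K, forall y : nat, `|q.[y%:R]| <= K * ((1 + r) / 2 / r) ^+ y.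
  by apply: poly_le_geometric; rewrite ltr_pdivlMr// mul1r.
exists (C * K), ((1 + r) / 2); split; [lra|lra|move=> y].
rewrite normrM -[X in X ^+ y](@mulfVK _ r) ?gt_eqF//.
rewrite exprMn [_ ^+ y * _]mulrC mulrACA.
by rewrite ler_pM.
Qed.

Lemma geometric_decayZ k v : geometric_decay v ->
  geometric_decay (fun y => k * v y).
Proof.
move=> [C [r [r0 r1 vC]]]; exists (`|k| * C), r; split=> // y.
by rewrite normrM -mulrA ler_wpM2l.
Qed.

End GeometricSeries.

(** * From nonnegativity on squares to nonnegative masses *)

Section MomentDeterminacy.
Variable R : realType.
Implicit Types (v : nat -> R) (C r t : R) (q : {poly R}).
Local Open Scope classical_set_scope.

Definition squares_nonneg v := forall q, 0 <= tsum (fun y => v y * q.[y%:R] ^+ 2).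

Lemma geometric_error_ge0 (s A r : R) : 0 <= r < 1 ->
  (forall n, 0 <= s + A * r ^+ n) -> 0 <= s.
Proof.
move=> /andP[r0 r1] h; have r1' : `|r| < 1 by rewrite ger0_norm.
have cA : s + A * r ^+ n @[n --> \oo] --> s + 0.
  by apply: cvgD; [exact: cvg_cst|exact: cvg_geometric].
rewrite -[s]addr0 -(cvg_lim _ cA)//.
by apply: limr_ge; [exact: cvgP cA|exact: nearW].
Qed.

Lemma geometric_decay_sq q v : geometric_decay v ->
  geometric_decay (fun y => v y * q.[y%:R] ^+ 2).
Proof.
move=> gv; rewrite (_ : (fun y => _) = fun y => v y * (q ^+ 2).[y%:R]); last first.
  by apply/funext => y; rewrite horner_exp.
exact: geometric_decayMp.
Qed.

(* [t ^ y] is the limit of its Newton interpolation polynomials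
   [\sum_(j < J) (t - 1) ^ j 'C(y, j)], which are exact for [y < J] and bounded
   by [(2 - t) ^ y]; for [t] close to 1 this is compatible with the decay. *)
Lemma squares_nonneg_geometric v C r1 r t :
  0 < r < r1 -> r1 < 1 -> 0 < t < 1 -> r1 * (2 - t) ^+ 2 < 1 ->
  geometric_bound v C r ->
  squares_nonneg v -> squares_nonneg (fun y => v y * (t ^+ 2) ^+ y).
Proof.
move=> /andP[r0 rr1] r11 /andP[t0 t1] rt vC vpos q.
have C0 : 0 <= C by have := vC 0%N; rewrite expr0 mulr1; apply: le_trans.
(* The gap between [r] and [r1] absorbs the factor [q ^ 2]. *)
have [K HK] : exists K, forall y : nat, `|(q ^+ 2).[y%:R]| <= K * (r1 / r) ^+ y.
  by apply: poly_le_geometric; rewrite ltr_pdivlMr// mul1r.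
pose w y := v y * q.[y%:R] ^+ 2.
have wC y : `|w y| <= C * K * r1 ^+ y.
  rewrite /w -horner_exp normrM -[X in X ^+ y](@mulfVK _ r) ?gt_eqF//.
  by rewrite exprMn [_ ^+ y * _]mulrC mulrACA ler_pM.
have CK0 : 0 <= C * K by have := wC 0%N; rewrite expr0 mulr1; apply: le_trans.
pose p J : {poly R} := \sum_(j < J) (t - 1) ^+ j *: binomp R j.
have pE J (y : nat) : (p J).[y%:R] = \sum_(j < J) (t - 1) ^+ j * 'C(y, j)%:R.
  rewrite horner_sum; apply: eq_bigr => j _.
  by rewrite hornerZ horner_binomp rbinom_nat.
have p_small J y : (y < J)%N -> (p J).[y%:R] = t ^+ y.
  by move=> yJ; rewrite pE sum_binomial// addrC subrK.
have p_le J y : `|(p J).[y%:R]| <= (2 - t) ^+ y.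
  rewrite pE (le_trans (ler_norm_sum _ _ _))//.
  have -> : 2 - t = 1 + (1 - t) by ring.
  have t1' : 0 <= 1 - t by lra.
  apply: le_trans (sum_binomial_le y J t1'); apply: ler_sum => j _.
  by rewrite normrM normrX distrC !ger0_norm.
set rho := r1 * (2 - t) ^+ 2 in rt.
have rho01 : 0 <= rho < 1 by rewrite rt andbT mulr_ge0 ?sqr_ge0//; lra.
(* The error of interpolation vanishes for [y < J] and decays at the rate [rho < 1], so its sum is
   of order [rho ^ J]. *)
pose e J y := w y * (t ^+ 2) ^+ y - w y * (p J).[y%:R] ^+ 2.
have e_small J y : (y < J)%N -> e J y = 0.
  by move=> yJ; rewrite /e p_small// exprAC subrr.
have e_le J : geometric_bound (e J) (2 * (C * K)) rho.
  move=> y; rewrite /e -mulrBr normrM /rho.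
  rewrite [(r1 * _) ^+ y]exprMn (_ : 2 * _ * _ = C * K * r1 ^+ y * (2 * (2 - t) ^+ 2 ^+ y)).
    rewrite ler_pM//.
    rewrite (le_trans (ler_normB _ _))//.
    have : `|(t ^+ 2) ^+ y| <= (2 - t) ^+ 2 ^+ y.
      rewrite normrX lerXn2r ?nnegrE ?sqr_ge0 ?normr_ge0// normrX.
      by rewrite lerXn2r ?nnegrE ?normr_ge0 ?gtr0_norm//; lra.
    have : `|(p J).[y%:R] ^+ 2| <= (2 - t) ^+ 2 ^+ y.
      rewrite exprAC normrX lerXn2r ?nnegrE ?normr_ge0// exprn_ge0//; lra.
    by move=> h1 h2; rewrite [leRHS]mulr_natl [leRHS]mulr2n lerD.
  by ring.
(* Up to this error, the sum is the quadratic form at [q * p J], nonnegative by hypothesis. *)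
have ev J : tsum (fun y => w y * (t ^+ 2) ^+ y) =
    tsum (fun y => v y * (q * p J).[y%:R] ^+ 2) + tsum (e J).
  rewrite -tsumD; last 2 first.
  - apply: geometric_decay_sq; exists C, r; split=> //; lra.
  - exists (2 * (C * K)), rho; split=> //.
    by rewrite mulr_gt0 ?exprn_gt0; lra.
  congr tsum; apply/funext => y; rewrite /e /w hornerM exprMn; ring.
have -> : (fun y => v y * t ^+ 2 ^+ y * q.[y%:R] ^+ 2) =
    (fun y => w y * (t ^+ 2) ^+ y) by apply/funext => y; rewrite /w mulrAC.
apply: (@geometric_error_ge0 _ (2 * (C * K) / (1 - rho)) rho) => // J.
have := tsum_tail J rho01 (e_le J).
rewrite big1 ?subr0 => [|i _]; last exact: e_small.
rewrite mulrAC ler_norml => /andP[eJ _].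
have := vpos (q * p J); have := ev J; lra.
Qed.

(* Multiplying [v] by [(t ^ 2N) ^ y] and testing on the square of the binomial
   polynomial [binomp m], which vanishes at [0, ..., m - 1], isolates the mass at
   [m] as [N] grows. *)
Theorem moment_determinacy v : geometric_decay v -> squares_nonneg v ->
  forall y, 0 <= v y.
Proof.
move=> [C [r [r0 r1 vC]]] vpos m.
pose r' := (1 + r) / 2.
have C0 : 0 <= C by have := vC 0%N; rewrite expr0 mulr1; apply: le_trans.
have rr' : 0 < r < r' by rewrite r0 /r' /=; lra.
have r'1 : r' < 1 by rewrite /r'; lra.
move: (r') rr' r'1 => {}r' rr' r'1.
(* With [d = 1 - r'], the condition [r' * (2 - t) ^+ 2 < 1] reads [(1 - d) * (1 + d / 4) ^+ 2 < 1];
   in the expansion all terms after 1 are negative. *)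
pose t := 1 - (1 - r') / 4.
have t01 : 0 < t < 1 by rewrite /t; lra.
have /andP[t0 t1] := t01.
have rt : r' * (2 - t) ^+ 2 < 1.
  have r'0 : 0 < r' by lra.
  rewrite /t (_ : r' * _ = 1 - (1 - r') / 2 - 7 * ((1 - r') ^+ 2 / 16) -
    (1 - r') ^+ 3 / 16); last first.
    by field.
  have : 0 < (1 - r') ^+ 2 by rewrite exprn_gt0//; lra.
  have : 0 < (1 - r') ^+ 3 by rewrite exprn_gt0//; lra.
  lra.
(* Since [t <= 1], the damped sequence keeps the bound [C * r ^+ y], so the same [t] serves at every
   iteration. *)
have posN N : squares_nonneg (fun y => v y * ((t ^+ 2) ^+ N) ^+ y).
  elim: N => [|N IHN].
    by under eq_fun do rewrite expr0 expr1n mulr1.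
  under eq_fun do rewrite exprSr exprMn mulrA.
  apply: (squares_nonneg_geometric rr' r'1 t01 rt (C := C)) => // y.
  rewrite normrM (le_trans _ (vC y))// ler_piMr//.
  rewrite ger0_norm; last by rewrite -!exprM exprn_ge0 ?(ltW t0).
  by rewrite -!exprM exprn_ile1// ltW.
have [K HK] : exists K, forall y : nat, `|(binomp R m ^+ 2).[y%:R]| <= K * (r' / r) ^+ y.
  by apply: poly_le_geometric; rewrite ltr_pdivlMr// mul1r; lra.
pose w y := v y * (binomp R m).[y%:R] ^+ 2.
have wC y : `|w y| <= C * K * r' ^+ y.
  rewrite /w -horner_exp normrM -[X in X ^+ y](@mulfVK _ r) ?gt_eqF//.
  by rewrite exprMn [_ ^+ y * _]mulrC mulrACA ler_pM.
have CK0 : 0 <= C * K by have := wC 0%N; rewrite expr0 mulr1; apply: le_trans.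
apply: (@geometric_error_ge0 _ (C * K / (1 - r')) (t ^+ 2)).
  by apply/andP; split; nra.
move=> N; set T := (t ^+ 2) ^+ N.
have T0 : 0 < T by rewrite /T -exprM exprn_gt0.
have T1 : T <= 1 by rewrite /T -exprM exprn_ile1// ltW.
have wT : geometric_bound (fun y => w y * T ^+ y) (C * K) (r' * T).
  move=> y; rewrite normrM (ger0_norm (exprn_ge0 y (ltW T0))).
  by rewrite exprMn mulrA ler_pM2r ?exprn_gt0.
have r'0 : 0 < r' by lra.
have r'T_le : r' * T <= r' by rewrite ler_piMr// ltW.
have r'T0 : 0 <= r' * T by rewrite mulr_ge0// ltW.
have r'T1 : r' * T < 1 by exact: le_lt_trans r'1.
have r'T : 0 <= r' * T < 1 by rewrite r'T0.
(* Of the first [m + 1] terms only [v m * T ^+ m] survives, and the tail is of order [T ^+ m.+1];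
   division by [T ^+ m] leaves [v m] plus a multiple of [T = (t ^+ 2) ^+ N]. *)
have := tsum_tail m.+1 r'T wT.
rewrite big_ord_recr big1 /= ?add0r => [|i _]; last first.
  by rewrite /w horner_binomp rbinom_nat bin_small// expr0n mulr0 mul0r.
have -> : w m = v m by rewrite /w horner_binomp rbinom_nat binn expr1n mulr1.
rewrite ler_norml => /andP[_].
have := posN N (binomp R m).
under eq_fun do rewrite mulrAC -/(w _).
rewrite -/T => S0 tail.
suff : 0 <= (v m + C * K / (1 - r') * T) * T ^+ m by rewrite pmulr_lge0 ?exprn_gt0.
apply: (le_trans S0); move: tail; rewrite lerBlDl => /le_trans; apply.
rewrite mulrDl lerD2l.
have h1 : (r' * T) ^+ m.+1 <= T ^+ m.+1.
  by rewrite lerXn2r ?nnegrE ?(ltW T0)// ler_piMl// ltW.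
have h2 : (1 - r' * T)^-1 <= (1 - r')^-1.
  by rewrite lef_pV2 ?posrE ?subr_gt0// lerD2l lerN2.
rewrite (_ : C * K / (1 - r') * T * T ^+ m = C * K * T ^+ m.+1 / (1 - r')); last first.
  by rewrite exprS; ring.
apply: ler_pM => //; last by rewrite ler_wpM2l.
- by rewrite mulr_ge0 ?exprn_ge0.
- by rewrite invr_ge0 subr_ge0 ltW.
Qed.

End MomentDeterminacy.

(** * Christoffel's formula and positivity of the modified functional *)

Section Christoffel.
Variables (R : realType) (L : {poly R} -> R) (p : nat -> {poly R}).
Variables (k : nat) (z : 'I_k -> R) (s : R).
Implicit Types (q r : {poly R}) (a x : R).

Definition node_poly : {poly R} := \prod_i ('X - (z i)%:P).

Definition casorati n : R := \det (\matrix_(i < k, j < k) (p (n + j)).[z i]).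

Hypothesis L_linear : forall a q r, L (a *: q + r) = a * L q + L r.
Hypothesis size_p : forall n, size (p n) = n.+1.
Hypothesis lead_p : forall n, 0 < lead_coef (p n).
Hypothesis orth_p : forall n q, (size q <= n)%N -> L (p n * q) = 0.
Hypothesis z_inj : injective z.

Let L0 : L 0 = 0.
Proof. by have := L_linear 1 0 0; rewrite scale1r addr0 mul1r; lra. Qed.

Let LD q r : L (q + r) = L q + L r.
Proof. by rewrite -[q in LHS]scale1r L_linear mul1r. Qed.

Let LZ a q : L (a *: q) = a * L q.
Proof. by rewrite -[X in L X]addr0 L_linear L0 addr0. Qed.

Let L_sum (I : finType) (g : I -> {poly R}) : L (\sum_i g i) = \sum_i L (g i).
Proof. exact: (big_morph L LD L0). Qed.

Lemma node_poly_monic : node_poly \is monic.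
Proof. exact: monic_prod_XsubC. Qed.

Lemma size_node_poly : size node_poly = k.+1.
Proof. by rewrite size_prod_XsubC /index_enum -enumT size_enum_ord. Qed.

Lemma node_poly_dvd q : (forall i, q.[z i] = 0) -> node_poly %| q.
Proof.
move=> qz; rewrite /node_poly -(big_map z xpredT (fun x => 'X - x%:P)).
apply: uniq_roots_dvdp; first by apply/allP => _ /mapP[i _ ->]; apply/rootP.
by rewrite uniq_rootsE map_inj_uniq// index_enum_uniq.
Qed.

(** The degrees are distinct, so the largest index with a nonzero coefficient determines the leading
    term. *)
Lemma lin_comb_p_neq0 m n (v : 'I_m -> R) j0 : v j0 != 0 ->
  \sum_j v j *: p (n + j) != 0.
Proof.
move=> v0; pose j1 := [arg max_(j > j0 | v j != 0) val j].
have [vj1 maxj1] : v j1 != 0 /\ forall j, v j != 0 -> (j <= j1)%N.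
  by rewrite /j1; case: arg_maxnP.
apply: contraNneq vj1 => /(congr1 (fun q : {poly R} => q`_(n + j1))).
rewrite coef0 coef_sum (bigD1 j1)//= big1 ?addr0 => [|j jj1].
  rewrite coefZ => /eqP; rewrite mulf_eq0 => /orP[//|].
  by have := lead_p (n + j1); rewrite lead_coefE size_p => /gt_eqF ->.
rewrite coefZ; have [vj|vj] := eqVneq (v j) 0; first by rewrite vj mul0r.
rewrite nth_default ?mulr0// size_p ltn_add2l ltn_neqAle maxj1// andbT.
by [].
Qed.

Let bordered n (x : R) : 'M[R]_k.+1 :=
  \matrix_(i, j) (p (n + j)).[if unlift ord_max i is Some i' then z i' else x].

(** Cofactors along the last row do not involve the variable, which is therefore set to 0. *)
Let cf n j := cofactor (bordered n 0) ord_max j.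

(* The determinant of the [p (n + j)] bordered by the nodes, expanded along the
   row of the variable; its quotient by [node_poly] is Christoffel's orthogonal
   polynomial for the modified functional. *)
Let B n : {poly R} := \sum_j cf n j *: p (n + j).

Let horner_B n x : (B n).[x] = \det (bordered n x).
Proof.
rewrite (expand_det_row _ ord_max) horner_sum; apply: eq_bigr => j _.
rewrite hornerZ mulrC mxE unlift_none; congr (_ * _); congr (_ * \det _).
by apply/matrixP => i l; rewrite !mxE liftK.
Qed.

Let B_node n i : (B n).[z i] = 0.
Proof.
rewrite horner_B; apply: (@determinant_alternate _ _ _ (lift ord_max i) ord_max).
  by rewrite eq_sym neq_lift.
by move=> j; rewrite !mxE liftK unlift_none.
Qed.

Let cf_max n : cf n ord_max = casorati n.
Proof.
rewrite /cf /cofactor /= addnn -signr_odd odd_double mul1r; congr (\det _).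
by apply/matrixP => i j; rewrite !mxE liftK lift_max.
Qed.

(** Deleting the first column shifts every degree by one; the sign is that of the corner position
    [(k, 0)]. *)
Let cf_0 n : cf n ord0 = (-1) ^+ k * casorati n.+1.
Proof.
rewrite /cf /cofactor /= addn0; congr (_ * \det _).
by apply/matrixP => i j; rewrite !mxE liftK lift0 addnS addSn.
Qed.

Let Q n : {poly R} := B n %/ node_poly.

Let BE n : B n = node_poly * Q n.
Proof. by rewrite mulrC divpK// node_poly_dvd. Qed.

(** [node_poly * Q n] is a combination of [p n, ..., p (n + k)], all orthogonal to degrees below
    [n]. *)
Let L_Q_small n r : (size r <= n)%N -> L (node_poly * Q n * r) = 0.
Proof.
move=> rn; rewrite -BE mulr_suml L_sum big1// => j _.
by rewrite -scalerAl LZ orth_p ?mulr0// (leq_trans rn)// leq_addr.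
Qed.

Let size_sum_p m n (v : 'I_m -> R) : (size (\sum_j v j *: p (n + j))%R <= n + m)%N.
Proof.
apply: (leq_trans (size_sum _ _ _)); apply/bigmax_leqP => j _.
by rewrite (leq_trans (size_scale_leq _ _))// size_p ltn_add2l.
Qed.

Let Q_lead n : casorati n != 0 ->
  size (Q n) = n.+1 /\ lead_coef (Q n) = casorati n * lead_coef (p (n + k)).
Proof.
move=> D0.
have B_coef : (B n)`_(n + k) = casorati n * lead_coef (p (n + k)).
  rewrite coef_sum big_ord_recr /= big1 ?add0r; last first.
    move=> j _; rewrite coefZ nth_default ?mulr0// size_p /= ltn_add2l.
    exact: ltn_ord.
  by rewrite coefZ cf_max lead_coefE size_p.
have B_nz : (B n)`_(n + k) != 0 by rewrite B_coef mulf_neq0// gt_eqF.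
have sB : size (B n) = (n + k).+1.
  apply/eqP; rewrite eqn_leq -{1}addnS size_sum_p /=.
  by rewrite ltnNge; apply: contra B_nz => h; rewrite nth_default.
have sQ : size (Q n) = n.+1.
  by rewrite size_divp ?monic_neq0 ?node_poly_monic// sB size_node_poly -addSn addnK.
split=> //; have := congr1 lead_coef (BE n).
by rewrite lead_coefM (monicP node_poly_monic) mul1r => <-; rewrite lead_coefE sB.
Qed.

Let L_p_lead n q : (size q <= n.+1)%N ->
  L (p n * q) = q`_n / lead_coef (p n) * L (p n ^+ 2).
Proof.
move=> qn; set a := _ / _.
have sr : (size (q - a *: p n)%R <= n)%N.
  apply/leq_sizeP => j nj; rewrite coefB coefZ.
  have [->|jn] := eqVneq j n.
    have lpE : (p n)`_n = lead_coef (p n) by rewrite lead_coefE size_p.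
    by rewrite /a lpE divfK ?subrr// gt_eqF.
  have {}nj : (n < j)%N by rewrite ltn_neqAle eq_sym jn.
  by rewrite !nth_default ?mulr0 ?subr0// ?size_p// (leq_trans qn).
rewrite -[q](subrK (a *: p n)) mulrDr LD orth_p// add0r -scalerAr LZ.
by rewrite expr2.
Qed.

(** In [B n * Q n] only the lowest term of [B n], with coefficient [cf n 0], pairs nontrivially with
    [Q n], of degree [n]; the leading coefficient of [Q n] contributes the other determinant. *)
Let L_Q_sq n : casorati n != 0 ->
  s * L (node_poly * Q n ^+ 2) = lead_coef (p (n + k)) / lead_coef (p n) *
    (s * (-1) ^+ k * casorati n * casorati n.+1 * L (p n ^+ 2)).
Proof.
move=> D0; have [sQ lQ] := Q_lead D0.
rewrite expr2 mulrA -BE mulr_suml L_sum big_ord_recl big1 ?addr0 => [|j _]; last first.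
  by rewrite -scalerAl LZ orth_p ?mulr0// sQ lift0 addnS ltnS leq_addr.
rewrite -scalerAl LZ cf_0 addn0 L_p_lead ?sQ//.
have -> : (Q n)`_n = lead_coef (Q n) by rewrite lead_coefE sQ.
by rewrite lQ; ring.
Qed.

(** Forward: if [casorati n] vanished, a nonzero combination [b] of the [p (n + j)] with [j < k]
    would be divisible by [node_poly], with a quotient [q] of degree below [n], so that
    [L (node_poly * q ^+ 2) = L (b * q) = 0]; otherwise test on [Q n]. Backward: the [Q n] form an
    orthogonal basis for the modified functional, with norms of the right sign. *)
Theorem christoffel_positivity :
  (forall q, q != 0 -> 0 < s * L (node_poly * q ^+ 2)) <->
  (forall n, 0 < s * (-1) ^+ k * casorati n * casorati n.+1 * L (p n ^+ 2)).
Proof.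
have lead_ratio n : 0 < lead_coef (p (n + k)) / lead_coef (p n).
  by rewrite divr_gt0.
split=> [pos n|pos].
  suff D0 : casorati n != 0.
    have [sQ _] := Q_lead D0.
    have : 0 < s * L (node_poly * Q n ^+ 2) by rewrite pos// -size_poly_gt0 sQ.
    by rewrite L_Q_sq// pmulr_rgt0.
  apply/negP => /det0P D0.
  (* Transposition makes the kernel vector a vector of coefficients for the [p (n + j)]. *)
  have /det0P[v v0 vD] : \det (\matrix_(i < k, j < k) (p (n + j)).[z i])^T == 0.
    by rewrite det_tr; apply/det0P.
  have [j0 vj0] : exists j, v 0 j != 0 by apply/rV0Pn.
  pose b := \sum_j v 0 j *: p (n + j).
  have b0 : b != 0 by exact: lin_comb_p_neq0 vj0.
  have bz i : b.[z i] = 0.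
    move/matrixP/(_ 0 i): vD; rewrite !mxE => <-; rewrite horner_sum.
    by apply: eq_bigr => j _; rewrite hornerZ !mxE.
  have bE : b = node_poly * (b %/ node_poly).
    by rewrite mulrC divpK// node_poly_dvd.
  have q0 : b %/ node_poly != 0 by apply: contraNneq b0 => q0; rewrite bE q0 mulr0.
  have := pos _ q0; rewrite expr2 mulrA -bE mulr_suml L_sum big1 ?mulr0 ?ltxx// => j _.
  rewrite -scalerAl LZ orth_p ?mulr0// (@leq_trans n) ?leq_addr//.
  rewrite size_divp ?monic_neq0 ?node_poly_monic// size_node_poly /=.
  by rewrite leq_subLR addnC size_sum_p.
have D0 n : casorati n != 0.
  by apply: contraTneq (pos n) => ->; rewrite !(mulr0, mul0r) ltxx.
have Q_pos n : 0 < s * L (node_poly * Q n ^+ 2) by rewrite L_Q_sq// mulr_gt0.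
suff pos_le n q : (size q <= n)%N -> (0 <= s * L (node_poly * q ^+ 2)) /\
    (q != 0 -> 0 < s * L (node_poly * q ^+ 2)).
  by move=> q; apply: (pos_le (size q) q (leqnn _)).2.
elim: n q => [|n IHn] q sq.
  move: sq; rewrite leqn0 size_poly_eq0 => /eqP ->.
  by rewrite expr0n mulr0 L0 mulr0 eqxx.
have [sQ lQ] := Q_lead (D0 n).
(* A Gram-Schmidt step: [r] has smaller degree, and the cross term vanishes by [L_Q_small]. *)
pose a := q`_n / lead_coef (Q n); pose r := q - a *: Q n.
have lQ0 : lead_coef (Q n) != 0 by rewrite lead_coef_eq0 -size_poly_gt0 sQ.
have sr : (size r <= n)%N.
  apply/leq_sizeP => j nj; rewrite coefB coefZ.
  have [->|jn] := eqVneq j n.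
    have QnE : (Q n)`_n = lead_coef (Q n) by rewrite lead_coefE sQ.
    by rewrite /a QnE divfK ?subrr.
  have {}nj : (n < j)%N by rewrite ltn_neqAle eq_sym jn.
  by rewrite !nth_default ?mulr0 ?subr0// ?sQ// (leq_trans sq).
have qE : s * L (node_poly * q ^+ 2) =
    a ^+ 2 * (s * L (node_poly * Q n ^+ 2)) + s * L (node_poly * r ^+ 2).
  have -> : node_poly * q ^+ 2 = a ^+ 2 *: (node_poly * Q n ^+ 2) +
      (node_poly * r ^+ 2 + (2 * a) *: (node_poly * Q n * r)).
    by rewrite /r -!mul_polyC !rmorphM rmorph_nat /=; ring.
  by rewrite LD LD !LZ L_Q_small//; ring.
have [r_ge0 r_gt0] := IHn r sr.
rewrite qE; have a_ge0 : 0 <= a ^+ 2 * (s * L (node_poly * Q n ^+ 2)).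
  by rewrite mulr_ge0 ?sqr_ge0// ltW.
split=> [|q0]; first exact: addr_ge0.
have [r0|/r_gt0] := eqVneq r 0; last by move=> ?; exact: ltr_wpDl.
have a0 : a != 0.
  apply: contraNneq q0 => a0.
  by rewrite -[q](subrK (a *: Q n)) -/r r0 a0 scale0r addr0.
by rewrite ltr_wpDr// mulr_gt0// exprn_even_gt0.
Qed.

End Christoffel.

(** * Finite differences of rising factorials *)

Section FiniteDifferences.
Variable R : realType.
Implicit Types (f : nat -> R) (c x : R) (l n : nat).

Lemma alternating_binomialS f n :
  \sum_(j < n.+2) (-1) ^+ j * 'C(n.+1, j)%:R * f j =
  \sum_(j < n.+1) (-1) ^+ j * 'C(n, j)%:R * (f j - f j.+1).
Proof.
under [RHS]eq_bigr do rewrite mulrBr.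
rewrite sumrB big_ord_recl [X in _ = X - _]big_ord_recl /= !bin0 -addrA; congr (_ + _).
under eq_bigr => j _ do rewrite /bump /= add1n binS natrD mulrDr mulrDl.
rewrite big_split /=; congr (_ + _).
  by rewrite big_ord_recr /= bin_small ?mulr0 ?mul0r ?addr0// ltnSn.
rewrite -sumrN; apply: eq_bigr => j _; by rewrite exprS; ring.
Qed.

Lemma pochhammerSl x n : pochhammer x n.+1 = x * pochhammer (x + 1) n.
Proof. by rewrite -add1n pochhammerD /pochhammer big_ord1 addr0. Qed.

(** Each difference lowers [l] by one and produces a factor [- l]. The falling factorial [l ^_ n]
    vanishes for [l < n], which is the source of orthogonality below. *)
Lemma alternating_pochhammer x l n :
  \sum_(j < n.+1) (-1) ^+ j * 'C(n, j)%:R * pochhammer (x + j%:R) l =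
  (-1) ^+ n * (l ^_ n)%:R * pochhammer (x + n%:R) (l - n).
Proof.
elim: n x l => [|n IHn] x l.
  by rewrite big_ord1 expr0 bin0 ffactn0 subn0.
rewrite (alternating_binomialS (fun j => pochhammer (x + j%:R) l)).
case: l => [|l].
  by rewrite ffact0n mulr0 mul0r big1// => j _; rewrite !pochhammer0 subrr mulr0.
have diff (j : nat) : pochhammer (x + j%:R) l.+1 - pochhammer (x + j.+1%:R) l.+1 =
    - l.+1%:R * pochhammer (x + 1 + j%:R) l.
  rewrite pochhammerSl pochhammerS.
  have -> : x + j%:R + 1 = x + 1 + j%:R by ring.
  have -> : x + j.+1%:R = x + 1 + j%:R by rewrite -natr1; ring.
  by rewrite -natr1; ring.
under eq_bigr do rewrite diff mulrCA.
rewrite -mulr_sumr IHn subSS (_ : x + n.+1%:R = x + 1 + n%:R) -?natr1; last by ring.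
by rewrite ffactSS natrM exprS; ring.
Qed.

End FiniteDifferences.

(** * The Meixner weight and its moments *)

Section MeixnerWeight.
Variables (R : realType) (a : R).
Hypothesis a01 : 0 < a < 1.
Implicit Types (c x : R) (q : {poly R}) (j l n y : nat).
Local Open Scope classical_set_scope.

Definition weight c y : R := pochhammer c y * a ^+ y / y`!%:R.

Definition weight_int c q : R := tsum (fun y => weight c y * q.[y%:R]).

Lemma geometric_decay_le (v w : nat -> R) : geometric_decay w ->
  (forall y, `|v y| <= `|w y|) -> geometric_decay v.
Proof.
by move=> [C [r [r0 r1 wC]]] vw; exists C, r; split=> // y; exact: le_trans (vw y) (wC y).
Qed.

Lemma pochhammer_fact M y : pochhammer (M.+1%:R : R) y = (M + y)`!%:R / M`!%:R.
Proof.
elim: y => [|y IHy]; first by rewrite pochhammer0 addn0 divff ?natr_fact_neq0.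
by rewrite pochhammerS IHy addnS factS natrM -natrD addSn; ring.
Qed.

(** With [|c| <= M + 1], the absolute value of [(c)_y / y!] is at most
    [(M + 1)_y / y! = 'C(y + M, M)], a polynomial in [y]. *)
Lemma weight_decay c : geometric_decay (weight c).
Proof.
case/andP: a01 => a0 a1; pose M := Num.truncn `|c|.
have cM : `|c| <= M.+1%:R by rewrite ltW// truncnS_gt.
pose q : {poly R} := binomp R M \Po ('X + M%:R%:P).
have ad : geometric_decay (fun y => a ^+ y).
  by exists 1, a; split=> // y; rewrite mul1r ger0_norm// exprn_ge0// ltW.
apply: geometric_decay_le (geometric_decayMp q ad) _ => y.
rewrite /weight mulrAC normrM [leRHS]normrM mulrC ler_wpM2l//.
rewrite horner_comp hornerD hornerX hornerC horner_binomp -natrD rbinom_nat.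
rewrite normrM normfV !(ger0_norm (ler0n _ _)) ler_pdivrMr ?ltr0n ?fact_gt0//.
have -> : 'C(y + M, M)%:R * y`!%:R = pochhammer (M.+1%:R : R) y.
  rewrite pochhammer_fact [(M + y)%N]addnC -(bin_fact (leq_addl y M)) addnK !natrM.
  by have := natr_fact_neq0 R M; move: (M`!%:R) => u u0; field.
rewrite normr_prod; apply: ler_prod => i _.
by rewrite normr_ge0 (le_trans (ler_normD _ _))// lerD// ger0_norm.
Qed.

Lemma weight_polyM_decay c q : geometric_decay (fun y => weight c y * q.[y%:R]).
Proof. exact/geometric_decayMp/weight_decay. Qed.

Lemma weight_int_linear c k q r :
  weight_int c (k *: q + r) = k * weight_int c q + weight_int c r.
Proof.
rewrite /weight_int -tsumZ; last exact: weight_polyM_decay.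
rewrite -tsumD; [|exact/geometric_decayZ/weight_polyM_decay|exact: weight_polyM_decay].
by congr tsum; apply/funext => y; rewrite hornerD hornerZ; ring.
Qed.

Lemma tsum_shift (v : nat -> R) n : geometric_decay v ->
  tsum v = \sum_(i < n) v i + tsum (fun y => v (n + y)%N).
Proof.
move=> /geometric_decay_cvg cv.
have h : series (fun y => v (n + y)%N) m @[m --> \oo] --> tsum v - \sum_(i < n) v i.
  have E m : series (fun y => v (n + y)%N) m =
      series v (m + n)%N - \sum_(i < n) v i.
    by rewrite !seriesEord /= addnC big_split_ord /= addrAC subrr add0r.
  under eq_fun do rewrite E.
  apply: cvgB; last exact: cvg_cst.
  by rewrite (cvg_shiftn n (series v)); exact: cv.
by rewrite {2}/tsum (cvg_lim _ h)// addrC subrK.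
Qed.

(** The binomial series, with value [(1 - a) ^ (- c)]. *)
Definition weight_mass c : R := tsum (weight c).

Lemma weight0 c : weight c 0 = 1.
Proof. by rewrite /weight pochhammer0 expr0 fact0 mul1r divr1. Qed.

(** Comparison of coefficients in [(1 - t) ^ (- c) = (1 - t) (1 - t) ^ (- c - 1)]. *)
Lemma weight_mass_shift c : weight_mass c = (1 - a) * weight_mass (c + 1).
Proof.
have step y : weight c (1 + y)%N = weight (c + 1) (1 + y)%N + - a * weight (c + 1) y.
  rewrite /weight add1n pochhammerSl pochhammerS factS natrM exprS -natr1.
  have := natr_fact_neq0 R y; move: (y`!%:R) => u u0.
  have : y%:R + 1 != 0 :> R by rewrite natr1.
  by move: y%:R => z z0; field; rewrite z0 u0.
have dw := weight_decay (c + 1).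
have dw1 : geometric_decay (fun y => weight (c + 1) (1 + y)%N).
  case: dw => [C [r [r0 r1 wC]]]; exists (C * r), r; split=> // y.
  by rewrite -mulrA -exprS -add1n; exact: wC.
rewrite /weight_mass (tsum_shift 1 (weight_decay c)) big_ord1 weight0.
under eq_fun do rewrite step.
rewrite tsumD ?tsumZ//; last exact: geometric_decayZ.
by rewrite (tsum_shift 1 dw) big_ord1 weight0; ring.
Qed.

Lemma weight_mass_addn c n : weight_mass c = (1 - a) ^+ n * weight_mass (c + n%:R).
Proof.
elim: n => [|n IHn]; first by rewrite expr0 mul1r addr0.
by rewrite IHn weight_mass_shift -addrA natr1 exprS; ring.
Qed.

(** Shifting the parameter until it is positive makes all masses nonnegative, and the mass at 0 is
    1. *)
Lemma weight_mass_gt0 c : 0 < weight_mass c.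
Proof.
case/andP: a01 => a0 a1; pose M := (Num.truncn `|c|).+1.
rewrite (weight_mass_addn c M) mulr_gt0 ?exprn_gt0 ?subr_gt0//.
have cM : 0 < c + M%:R.
  have h : `|c| < M%:R by exact: truncnS_gt.
  by have := ler_norm (- c); rewrite normrN; lra.
apply: (@lt_le_trans _ _ (weight (c + M%:R) 0)); first by rewrite weight0.
apply: tsum_ge_term; first exact: weight_decay.
by move=> y; rewrite /weight divr_ge0// mulr_ge0 ?exprn_ge0 ?ltW ?pochhammer_gt0.
Qed.

(** The first [j] terms vanish, and the remaining ones form a multiple of the weight with parameter
    [c + j]. *)
Lemma weight_int_binomp c j : weight_int c (binomp R j) =
  pochhammer c j * (a / (1 - a)) ^+ j / j`!%:R * weight_mass c.
Proof.
case/andP: a01 => a0 a1.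
rewrite /weight_int (tsum_shift j (weight_polyM_decay c _)) big1 ?add0r; last first.
  by move=> i _; rewrite horner_binomp rbinom_nat bin_small ?mulr0.
have E y : weight c (j + y)%N * (binomp R j).[(j + y)%:R] =
    pochhammer c j * a ^+ j / j`!%:R * weight (c + j%:R) y.
  rewrite horner_binomp rbinom_nat /weight pochhammerD exprD.
  have := congr1 (fun n => n%:R : R) (bin_fact (leq_addr y j)).
  rewrite /= addKn !natrM => <-.
  have b0 : 'C(j + y, j)%:R != 0 :> R by rewrite pnatr_eq0 -lt0n bin_gt0 leq_addr.
  have := natr_fact_neq0 R j; have := natr_fact_neq0 R y.
  move: (j`!%:R) (y`!%:R) ('C(_, _)%:R) b0 => u v b b0 u0 v0.
  by field; rewrite u0 v0 b0.
under eq_fun do rewrite E.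
rewrite tsumZ; last exact: weight_decay.
rewrite -/(weight_mass _) (weight_mass_addn c j) exprMn exprVn.
have : (1 - a) ^+ j != 0 by rewrite expf_neq0// subr_eq0 gt_eqF.
have := natr_fact_neq0 R j; move: (j`!%:R) ((1 - a) ^+ j) => u v u0 v0.
by field; rewrite u0 v0.
Qed.

Definition risep c l : {poly R} := \prod_(i < l) ('X - (- (c + i%:R))%:P).

Lemma horner_risep c l x : (risep c l).[x] = pochhammer (x + c) l.
Proof.
rewrite horner_prod; apply: eq_bigr => i _.
by rewrite hornerXsubC opprK addrA.
Qed.

(** Since [(c)_y (y + c)_l = (c)_l (c + l)_y], the factor [risep c l] merely moves the parameter;
    this makes these polynomials a convenient basis for testing orthogonality. *)
Lemma weight_int_risep c l q :
  weight_int c (risep c l * q) = pochhammer c l * weight_int (c + l%:R) q.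
Proof.
rewrite /weight_int -tsumZ; last exact: weight_polyM_decay.
congr tsum; apply/funext => y; rewrite hornerM horner_risep /weight.
have h : pochhammer c y * pochhammer (y%:R + c) l =
    pochhammer c l * pochhammer (c + l%:R) y.
  by rewrite (addrC _ c) -!pochhammerD addnC.
have rearrange (A B D E X V Q : R) : A * B = D * E ->
    A * X * V * (B * Q) = D * (E * X * V * Q).
  move=> AB; have -> : A * X * V * (B * Q) = A * B * X * V * Q by ring.
  by rewrite AB; ring.
exact: rearrange.
Qed.

Lemma risep_monic c l : risep c l \is monic.
Proof. exact: monic_prod_XsubC. Qed.

Lemma size_risep c l : size (risep c l) = l.+1.
Proof. by rewrite size_prod_XsubC /index_enum -enumT size_enum_ord. Qed.

End MeixnerWeight.

(** * Meixner polynomials in the binomial basis *)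

Section MeixnerPolynomials.
Variables (R : realType) (a c : R).
Hypotheses (a0 : a != 0) (a1 : 1 - a != 0).
Implicit Types (d x y : R) (j m n : nat).

Let tau := a / (1 - a).

(** The expansion in the basis whose moments are explicit; [horner_meixnerp] identifies it with
    [meixner]. *)
Definition meixnerp n : {poly R} :=
  \sum_(j < n.+1) (rbinom (- c - j%:R) (n - j) * tau ^+ (n - j)) *: binomp R j.

Lemma rbinom_pascal y m : rbinom (y + 1) m.+1 = rbinom y m.+1 + rbinom y m.
Proof.
have -> : rbinom (y + 1) m.+1 = rbinom y m * (y + 1) / m.+1%:R.
  rewrite /rbinom big_ord_recl factS natrM subr0.
  under eq_bigr => i _ do rewrite /= /bump /= add1n -natr1 opprD addrACA subrr addr0.
  have := natr_fact_neq0 R m; have : m.+1%:R != 0 :> R by rewrite pnatr_eq0.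
  move: (m`!%:R) (m.+1%:R) (\prod_(_ < _) _) => u v P v0 u0.
  by field; rewrite u0 v0.
have : m.+1%:R != 0 :> R by rewrite pnatr_eq0.
by rewrite rbinomS -natr1 => m0; field.
Qed.

Lemma sum_pascal (g : nat -> R) m n :
  \sum_(j < n.+2) 'C(m.+1, j)%:R * g j =
  \sum_(j < n.+2) 'C(m, j)%:R * g j + \sum_(j < n.+1) 'C(m, j)%:R * g j.+1.
Proof.
rewrite big_ord_recl [X in _ = X + _]big_ord_recl /= !bin0 -addrA; congr (_ + _).
rewrite -big_split /=; apply: eq_bigr => j _.
by rewrite /bump /= add1n binS natrD mulrDl.
Qed.

(* Both sides are the coefficient of [s ^ n] in [(1 + s) ^ d (1 + s / a) ^ m]. *)
Lemma meixner_convolution d m n :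
  \sum_(j < n.+1) 'C(m, j)%:R * (a ^- j * rbinom d (n - j)) =
  \sum_(j < n.+1) 'C(m, j)%:R *
    ((a^-1 - 1) ^+ j * rbinom (d + m%:R - j%:R) (n - j)).
Proof.
elim: m n => [|m IHm] n.
  rewrite !big_ord_recl !bin0 !big1 => [|j _|j _]; last 2 first.
  - by rewrite mul0r.
  - by rewrite mul0r.
  by rewrite /= !expr0 invr1 !addr0 subr0.
case: n => [|n]; first by rewrite !big_ord1 !subn0 !rbinom0 !expr0 !bin0 invr1.
rewrite (sum_pascal (fun j => a ^- j * rbinom d (n.+1 - j))).
rewrite (sum_pascal (fun j => (a^-1 - 1) ^+ j *
  rbinom (d + m.+1%:R - j%:R) (n.+1 - j))).
rewrite IHm.
rewrite (eq_bigr (fun j : 'I_n.+1 => a^-1 * ('C(m, j)%:R *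
    (a ^- j * rbinom d (n - j))))); last first.
  by move=> j _; rewrite subSS exprS invfM; ring.
rewrite -mulr_sumr IHm big_ord_recr [in RHS]big_ord_recr /= !subnn !rbinom0.
rewrite -!addrA [RHS]addrA [RHS]addrAC -!big_split /= [in LHS]addrC -addrA.
rewrite addrC; congr (_ + _).
rewrite mulr_sumr -big_split /=; apply: eq_bigr => j _.
have -> : d + m.+1%:R - j%:R = d + m%:R - j%:R + 1 by rewrite -natr1; ring.
have -> : d + m.+1%:R - j.+1%:R = d + m%:R - j%:R by rewrite -!natr1; ring.
rewrite subSn -1?ltnS// rbinom_pascal subSS exprS; ring.
Qed.

Lemma poly_eq_nat (p q : {poly R}) : (forall m, p.[m%:R] = q.[m%:R]) -> p = q.
Proof.
move=> pq; apply/eqP; rewrite -subr_eq0; apply/contraT => pq0.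
pose rs := [seq i%:R : R | i <- iota 0 (size (p - q))].
have /(max_poly_roots pq0) : all (root (p - q)) rs.
  by apply/allP => _ /mapP[i _ ->]; rewrite rootE hornerD hornerN pq subrr.
rewrite map_inj_uniq ?iota_uniq => [|i j /eqP]; last by rewrite eqr_nat => /eqP.
by rewrite size_map size_iota ltnn => /(_ isT).
Qed.

(** Both sides are polynomial in [x], so natural arguments [m] suffice; there the identity is
    [meixner_convolution] with [d = - m - c]. *)
Lemma horner_meixnerp n x : (meixnerp n).[x] = meixner a c n x.
Proof.
pose q : {poly R} := (a ^+ n / (1 - a) ^+ n) *: \sum_(j < n.+1)
  a ^- j *: (binomp R j * (binomp R (n - j) \Po (- 'X - c%:P))).
have qE y : q.[y] = meixner a c n y.
  rewrite hornerZ horner_sum; congr (_ * _); apply: eq_bigr => j _.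
  by rewrite hornerZ hornerM horner_comp !horner_binomp hornerD !hornerN hornerX hornerC mulrA.
rewrite -qE; congr (_.[_]); apply: poly_eq_nat => m; rewrite qE /meixner.
under eq_bigr => j _ do rewrite rbinom_nat [_ * 'C(_, _)%:R]mulrC -mulrA.
rewrite meixner_convolution mulr_sumr horner_sum; apply: eq_bigr => j _.
rewrite hornerZ horner_binomp rbinom_nat.
have -> : - m%:R - c + m%:R - j%:R = - c - j%:R by ring.
have jn : (j <= n)%N by rewrite -ltnS.
have -> : a ^+ n / (1 - a) ^+ n = tau ^+ (n - j) * tau ^+ j.
  by rewrite -exprD subnK// exprMn exprVn.
have ut : tau ^+ j * (a^-1 - 1) ^+ j = 1.
  by rewrite -exprMn (_ : tau * _ = 1) ?expr1n// /tau; field; rewrite a0 a1.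
have rearrange (T U V X Y : R) : U * V = 1 -> T * U * (Y * (V * X)) = X * T * Y.
  move=> UV; have -> : T * U * (Y * (V * X)) = U * V * (X * T * Y) by ring.
  by rewrite UV mul1r.
by apply/esym/rearrange.
Qed.

Lemma coef_meixnerp n : (meixnerp n)`_n = n`!%:R^-1.
Proof.
rewrite coef_sum big_ord_recr /= big1 ?add0r => [|j _]; last first.
  by rewrite coefZ nth_default ?mulr0// size_binomp.
rewrite subnn rbinom0 expr0 mulr1 scale1r coefZ.
have -> : (\prod_(i < n) ('X - i%:R%:P) : {poly R})`_n = 1.
  set P := \prod_(i < n) _; have sP : size P = n.+1.
    by rewrite size_prod_XsubC /index_enum -enumT size_enum_ord.
  by have /monicP := monic_prod_XsubC (index_enum 'I_n) xpredT (fun i => i%:R : R);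
    rewrite lead_coefE -/P sP.
by rewrite mulr1.
Qed.

Lemma size_meixnerp n : size (meixnerp n) = n.+1.
Proof.
apply/eqP; rewrite eqn_leq; apply/andP; split.
  apply: (leq_trans (size_sum _ _ _)); apply/bigmax_leqP => j _.
  by rewrite (leq_trans (size_scale_leq _ _))// size_binomp.
rewrite ltnNge; apply/negP => /leq_sizeP/(_ n (leqnn n)) /eqP.
by rewrite coef_meixnerp invr_eq0 (negPf (natr_fact_neq0 _ _)).
Qed.

Lemma lead_coef_meixnerp n : lead_coef (meixnerp n) = n`!%:R^-1.
Proof. by rewrite lead_coefE size_meixnerp coef_meixnerp. Qed.

End MeixnerPolynomials.

(** * Orthogonality and norms of the Meixner polynomials *)

Section MeixnerOrthogonality.
Variables (R : realType) (a c : R).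
Hypothesis a01 : 0 < a < 1.
Implicit Types (x : R) (q : {poly R}) (j l m n : nat).

Let a_gt0 : 0 < a. Proof. by case/andP: a01. Qed.
Let a_lt1 : 0 < 1 - a. Proof. by case/andP: a01 => _; rewrite subr_gt0. Qed.
Let tau := a / (1 - a).
Let tau_gt0 : 0 < tau. Proof. exact: divr_gt0. Qed.

Lemma rbinom_opp x m : rbinom (- x) m = (-1) ^+ m * pochhammer x m / m`!%:R.
Proof.
rewrite /rbinom; congr (_ / _); rewrite /pochhammer.
elim: m => [|m IHm]; first by rewrite !big_ord0 mulr1.
by rewrite !big_ord_recr /= IHm exprS; ring.
Qed.

(** Inserting the moments of the binomial polynomials leaves the alternating sum of the [(c + j)_l],
    an [n]-th difference evaluated by [alternating_pochhammer]. *)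
Lemma weight_int_risep_meixnerp l n :
  weight_int a c (risep c l * meixnerp a c n) =
  pochhammer c n * tau ^+ n / n`!%:R * weight_mass a (c + l%:R) *
  ((l ^_ n)%:R * pochhammer (c + n%:R) (l - n)).
Proof.
rewrite weight_int_risep//.
have -> : weight_int a (c + l%:R) (meixnerp a c n) = \sum_(j < n.+1)
    rbinom (- c - j%:R) (n - j) * tau ^+ (n - j) *
    weight_int a (c + l%:R) (binomp R j).
  rewrite /meixnerp; elim/big_rec2: _ => [|j y1 y2 _ IH].
    by have := weight_int_linear a01 (c + l%:R) 1 0 0; rewrite scale1r addr0; lra.
  by rewrite weight_int_linear// IH.
have -> : (l ^_ n)%:R * pochhammer (c + n%:R) (l - n) = (-1) ^+ n *
    \sum_(j < n.+1) (-1) ^+ j * 'C(n, j)%:R * pochhammer (c + j%:R) l.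
  by rewrite alternating_pochhammer !mulrA -expr2 sqrr_sign mul1r.
rewrite !mulr_sumr; apply: eq_bigr => j _.
have jn : (j <= n)%N by rewrite -ltnS.
rewrite weight_int_binomp// (_ : - c - j%:R = - (c + j%:R)); last by ring.
rewrite rbinom_opp -/tau.
have -> : (-1) ^+ n * ((-1) ^+ j * 'C(n, j)%:R * pochhammer (c + j%:R) l) =
    (-1) ^+ (n - j) * 'C(n, j)%:R * pochhammer (c + j%:R) l.
  by rewrite -{1}(subnK jn) exprD !mulrA -[_ * _ * (-1) ^+ j]mulrA -expr2 sqrr_sign mulr1.
have key1 : pochhammer c l * pochhammer (c + l%:R) j =
    pochhammer c j * pochhammer (c + j%:R) l.
  by rewrite -!pochhammerD addnC.
have -> : pochhammer c n = pochhammer c j * pochhammer (c + j%:R) (n - j).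
  by rewrite -pochhammerD subnKC.
have -> : tau ^+ n = tau ^+ (n - j) * tau ^+ j by rewrite -exprD subnK.
have /(congr1 (fun n => n%:R : R)) := bin_fact jn; rewrite !natrM => <-.
have b0 : 'C(n, j)%:R != 0 :> R by rewrite pnatr_eq0 -lt0n bin_gt0.
have := natr_fact_neq0 R j; have := natr_fact_neq0 R (n - j).
have rearrange (K1 K2 K3 K4 s P T T' u v b S : R) : u != 0 -> v != 0 -> b != 0 ->
    K1 * K2 = K3 * K4 ->
    K1 * (s * P / u * T * (K2 * T' / v * S)) =
    K3 * P * (T * T') / (b * (v * u)) * S * (s * b * K4).
  move=> u0 v0 b0' K.
  have -> : K1 * (s * P / u * T * (K2 * T' / v * S)) =
    (K1 * K2) * (s * P / u * T * (T' / v * S)) by ring.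
  by rewrite K; field; rewrite u0 v0 b0'.
by move=> u0 v0; exact: rearrange.
Qed.

Let size_subr_risep q l : size q = l.+1 ->
  (size (q - lead_coef q *: risep c l)%R <= l)%N.
Proof.
move=> sl; apply/leq_sizeP => i li; rewrite coefB coefZ.
have [->|il] := eqVneq i l.
  have -> : (risep c l)`_l = 1.
    by have /monicP := risep_monic c l; rewrite lead_coefE size_risep.
  by rewrite mulr1 lead_coefE sl subrr.
have {}il : (l < i)%N by rewrite ltn_neqAle eq_sym il.
by rewrite !nth_default ?mulr0 ?subr0// ?size_risep// sl.
Qed.

(** Induction on the degree [l] of [q]: the leading term in the [risep] basis contributes
    [l ^_ n = 0]. *)
Lemma meixnerp_orth n q : (size q <= n)%N -> weight_int a c (meixnerp a c n * q) = 0.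
Proof.
have [m] := ubnP (size q); elim: m q => // m IHm q; rewrite ltnS => sm sn.
have wD := weight_int_linear a01 c.
have [->|q0] := eqVneq q 0.
  by have := wD 1 0 0; rewrite scale1r addr0 mulr0; lra.
pose l := (size q).-1; have sl : size q = l.+1 by rewrite prednK// size_poly_gt0.
have sr := size_subr_risep sl; set r := (q - _) in sr.
have -> : q = lead_coef q *: risep c l + r by rewrite addrC subrK.
rewrite mulrDr -scalerAr wD [meixnerp _ _ _ * risep _ _]mulrC weight_int_risep_meixnerp.
rewrite ffact_small -?sl// mul0r !mulr0 add0r IHm//.
  by rewrite (leq_ltn_trans sr)// -ltnS -sl.
by rewrite (leq_trans sr)// ltnW// -sl.
Qed.

(** By orthogonality one factor may be replaced by its leading term in the [risep] basis. *)
Lemma weight_int_meixnerp_sq n :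
  exists2 d, 0 < d & weight_int a c (meixnerp a c n ^+ 2) = d * pochhammer c n.
Proof.
exists (tau ^+ n / n`!%:R * weight_mass a (c + n%:R)).
  by rewrite mulr_gt0 ?weight_mass_gt0// divr_gt0 ?exprn_gt0// ltr0n fact_gt0.
have sr := size_subr_risep (size_meixnerp a c n).
set r := (_ - _) in sr.
rewrite expr2; have {2}-> : meixnerp a c n =
    lead_coef (meixnerp a c n) *: risep c n + r by rewrite addrC subrK.
rewrite mulrDr -scalerAr weight_int_linear// (meixnerp_orth sr) addr0.
rewrite [meixnerp _ _ _ * risep _ _]mulrC weight_int_risep_meixnerp.
rewrite lead_coef_meixnerp ffactnn subnn pochhammer0.
have := natr_fact_neq0 R n; move: (n`!%:R) => u u0; field.
by [].
Qed.

End MeixnerOrthogonality.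

(** * Duality between degree and variable, and reflection *)

Section MeixnerDuality.
Variables (R : realType) (a c : R).
Hypotheses (a0 : a != 0) (a1 : 1 - a != 0).
Hypothesis hc : forall m : nat, c <> - m%:R.
Implicit Types (x : R) (j m n : nat).

Let tau := a / (1 - a).

(** The value of the [n]-th Meixner polynomial at 0. *)
Definition dual_factor n : R := (- tau) ^+ n * pochhammer c n / n`!%:R.

Let tau0 : tau != 0. Proof. by rewrite mulf_neq0 ?invr_eq0. Qed.

Lemma dual_factor_neq0 n : dual_factor n != 0.
Proof.
by rewrite !mulf_neq0 ?invr_eq0 ?natr_fact_neq0 ?pochhammer_neq0// expf_neq0 ?oppr_eq0.
Qed.

(* This is [2F1(- n, - m; c; 1 - 1 / a)]. *)
Let kernel n m : R := \sum_(j < (n + m).+1)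
  'C(n, j)%:R * 'C(m, j)%:R * (j`!%:R / (pochhammer c j * (- tau) ^+ j)).

Let meixner_kernel n m : meixner a c n m%:R = dual_factor n * kernel n m.
Proof.
(* The terms of [kernel] with [j > n] vanish; summing up to [n + m] makes its symmetry visible. *)
rewrite -horner_meixnerp// horner_sum mulr_sumr -addSn big_split_ord /=.
rewrite [X in _ = _ + X]big1; last first.
  by move=> j _; rewrite bin_small ?mul0r ?mulr0// ltnS leq_addr.
rewrite addr0; apply: eq_bigr => j _.
have jn : (j <= n)%N by rewrite -ltnS.
rewrite hornerZ horner_binomp rbinom_nat (_ : - c - j%:R = - (c + j%:R)); last by ring.
rewrite rbinom_opp /dual_factor -/tau.
have -> : pochhammer c n = pochhammer c j * pochhammer (c + j%:R) (n - j).
  by rewrite -pochhammerD subnKC.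
have -> : (- tau) ^+ n = (-1) ^+ (n - j) * tau ^+ (n - j) * (- tau) ^+ j.
  by rewrite -exprNn -exprD subnK.
have /(congr1 (fun n => n%:R : R)) := bin_fact jn; rewrite !natrM => <-.
have b0 : 'C(n, j)%:R != 0 :> R by rewrite pnatr_eq0 -lt0n bin_gt0.
have p0 := pochhammer_neq0 j hc.
have t0 : (- tau) ^+ j != 0 by rewrite expf_neq0 ?oppr_eq0.
have rearrange (s P u T b' K t b v : R) :
    u != 0 -> v != 0 -> b != 0 -> K != 0 -> t != 0 ->
    s * P / u * T * b' = s * T * t * (K * P) / (b * (v * u)) * (b * b' * (v / (K * t))).
  by move=> u0 v0 b0' K0 t0'; field; rewrite u0 v0 b0' K0 t0'.
exact: rearrange (natr_fact_neq0 _ _) (natr_fact_neq0 _ _) b0 p0 t0.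
Qed.

Lemma meixner_duality n m :
  meixner a c n m%:R = dual_factor n / dual_factor m * meixner a c m n%:R.
Proof.
have kernelC : kernel n m = kernel m n.
  by rewrite /kernel addnC; apply: eq_bigr => j _; rewrite ['C(n, j)%:R * _]mulrC.
rewrite !meixner_kernel kernelC; have := dual_factor_neq0 m.
by move: (dual_factor m) (dual_factor n) => u v u0; field.
Qed.

(** Reversing the order of summation exchanges the two binomials. *)
Lemma meixner_reflection n x :
  meixner a^-1 c n x = (-1) ^+ n * meixner a c n (- x - c).
Proof.
have -> : meixner a c n (- x - c) = (a / (1 - a)) ^+ n * \sum_(j < n.+1)
    a ^- (n - j) * rbinom (- x - c) (n - j) * rbinom x j.
  rewrite /meixner -exprVn -exprMn (reindex_inj rev_ord_inj) /=; congr (_ * _).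
  apply: eq_bigr => j _; rewrite subSS subKn -1?ltnS//.
  by congr (_ * rbinom _ _); ring.
rewrite /meixner !mulr_sumr; apply: eq_bigr => j _.
have jn : (j <= n)%N by rewrite -ltnS.
have h : a^-1 ^+ n / (1 - a^-1) ^+ n * a^-1 ^- j =
    (-1) ^+ n * (a / (1 - a)) ^+ n * a ^- (n - j).
  have -> : a^-1 ^+ n / (1 - a^-1) ^+ n = (-1) ^+ n * (1 - a)^-1 ^+ n.
    rewrite -exprVn -!exprMn; congr (_ ^+ n); field.
    have n1 : a - 1 != 0 by rewrite -opprB oppr_eq0.
    by rewrite ?n1 ?a0 ?a1.
  have an : a ^+ n = a ^+ (n - j) * a ^+ j by rewrite -exprD subnK.
  rewrite [a^-1 ^+ j]exprVn invrK exprMn an.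
  by field; rewrite ?expf_neq0 ?a1.
have rearrange (X Y B C s t A : R) : X * Y = s * t * A ->
    X * (Y * B * C) = s * (t * (A * C * B)).
  by move=> XY; rewrite -mulrA mulrA XY; ring.
exact: rearrange.
Qed.

End MeixnerDuality.

(** * From [Omega] to the Casorati determinant *)

Section OmegaSign.
Variables (R : realType) (a c : R) (F : {fset nat} * {fset nat}).
Hypothesis a01 : 0 < a < 1.
Hypothesis hc : forall m : nat, c <> - m%:R.
Implicit Types (f j n : nat).

Let a_gt0 : 0 < a. Proof. by case/andP: a01. Qed.
Let a_lt1 : 0 < 1 - a. Proof. by case/andP: a01 => _; rewrite subr_gt0. Qed.
Let a0 : a != 0. Proof. by rewrite gt_eqF. Qed.
Let a1 : 1 - a != 0. Proof. by rewrite gt_eqF. Qed.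
Let aV0 : a^-1 != 0. Proof. by rewrite invr_eq0. Qed.
Let aV1 : 1 - a^-1 != 0.
Proof. by rewrite subr_eq0 eq_sym invr_eq1 lt_eqF//; case/andP: a01. Qed.

Let kappa := dual_factor a c.
Let kappaV := dual_factor a^-1 c.

Let kappa_neq0 n : kappa n != 0. Proof. exact: dual_factor_neq0. Qed.
Let kappaV_neq0 n : kappaV n != 0. Proof. exact: dual_factor_neq0. Qed.

(** Inverting [a] divides [a / (1 - a)] by [- a]. *)
Let kappaVE n : kappaV n * ((-1) ^+ n * a ^+ n) = kappa n.
Proof.
rewrite /kappaV /kappa /dual_factor.
have -> : - (a / (1 - a)) = - (a^-1 / (1 - a^-1)) * (-1 * a).
  have n1 : a - 1 != 0 by rewrite -opprB oppr_eq0.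
  by field; rewrite ?n1 ?a0 ?a1.
by rewrite !exprMn; ring.
Qed.

Let sq_gt0 (x : R) : x != 0 -> 0 < x ^+ 2.
Proof. by move=> x0; rewrite exprn_even_gt0. Qed.

Let p := meixnerp a c.

Lemma meixner_dual f n : meixner a c f n%:R = kappa f * (p n).[f%:R] / kappa n.
Proof. by rewrite meixner_duality// horner_meixnerp// mulrAC. Qed.

(** Duality for [1 / a] followed by reflection gives values at the nodes [- f - c]; by [kappaVE] the
    denominators are those of [meixner_dual], so they factor out of the columns. *)
Lemma meixnerV_dual f n :
  meixner a^-1 c f n%:R = kappaV f * a ^+ n * (p n).[- f%:R - c] / kappa n.
Proof.
rewrite meixner_duality// meixner_reflection// horner_meixnerp// -kappaVE.
rewrite -/(kappaV f) -/(kappaV n).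
have s2 : (-1) ^+ n * (-1) ^+ n = 1 :> R by rewrite -expr2 sqrr_sign.
have s0 : (-1) ^+ n != 0 :> R by rewrite signr_eq0.
have an0 : a ^+ n != 0 by rewrite expf_neq0.
have := kappaV_neq0 n; move: (kappaV n) (kappaV f) (a ^+ n) an0 => u v A A0 u0.
move: ((-1) ^+ n) s2 s0 (meixner _ _ _ _) => s s2 s0 M.
have -> : v / u * (s * M) = (s * s) * (v * M / (u * s)) by field; rewrite s0 u0.
by rewrite s2; field; rewrite A0 s0 u0.
Qed.

Definition row_factor n (i : 'I_(kF F)) : R :=
  match fintype.split i with
  | inl i1 => kappa (nth_elt F.1 i1)
  | inr i2 => kappaV (nth_elt F.2 i2) * a ^+ n
  end.

(** In the rows of [F.2] the division by [a ^+ j] leaves [a ^+ n], constant along the row; each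
    remaining factor depends on the row alone or on the column alone and comes out as a diagonal
    matrix. *)
Lemma Omega_casorati n : Omega F a c n%:R =
  \prod_i row_factor n i * casorati p (@node R F c) n *
  \prod_(j < kF F) (kappa (n + j)%N)^-1.
Proof.
pose rowd : 'rV[R]_(kF F) := \row_i row_factor n i.
pose cold : 'rV[R]_(kF F) := \row_j (kappa (n + j)%N)^-1.
pose M : 'M[R]_(kF F) := \matrix_(i, j) (p (n + j)).[node c i].
have -> : \prod_i row_factor n i = \det (diag_mx rowd).
  by rewrite det_diag; apply: eq_bigr => i _; rewrite mxE.
have -> : \prod_(j < kF F) (kappa (n + j)%N)^-1 = \det (diag_mx cold).
  by rewrite det_diag; apply: eq_bigr => i _; rewrite mxE.
rewrite -det_mulmx -det_mulmx; congr (\det _); apply/matrixP => i j.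
rewrite mul_mx_diag mul_diag_mx !mxE /row_factor /node.
case: (fintype.splitP i) => i' i'E; rewrite mxE.
  by rewrite -natrD meixner_dual.
rewrite -natrD meixnerV_dual exprD -/kappa.
have := kappa_neq0 (n + j)%N; have : a ^+ j != 0 by rewrite expf_neq0.
move: (a ^+ j) (a ^+ n) (kappaV _) (kappa _) (p _).[_] => A A' u v P A0 v0.
by field; rewrite A0 v0.
Qed.

Lemma row_factor_mul_gt0 n i : 0 < row_factor n i * row_factor n.+1 i.
Proof.
rewrite /row_factor; case: fintype.split => j /=.
  by rewrite -expr2; exact: sq_gt0.
rewrite mulrACA -expr2; apply: mulr_gt0; first exact: sq_gt0.
by rewrite mulr_gt0 ?exprn_gt0.
Qed.

(** Up to squares the two products telescope to [kappa n * kappa (n + k)], and [kappa n] has the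
    sign of [(-1) ^ n (c)_n]. *)
Lemma prod_kappa k n : exists2 d, 0 < d &
  \prod_(j < k) (kappa (n + j)%N)^-1 * \prod_(j < k) (kappa (n.+1 + j)%N)^-1 =
  d * ((-1) ^+ k * pochhammer c n * pochhammer c (n + k)).
Proof.
have tau0 : 0 < a / (1 - a) by exact: divr_gt0.
have [d d0 dE] : exists2 d, 0 < d &
    \prod_(j < k) (kappa (n + j)%N)^-1 * \prod_(j < k) (kappa (n.+1 + j)%N)^-1 =
    d * (kappa n * kappa (n + k)%N).
  elim: k => [|k [d d0 IHk]].
    exists (kappa n ^- 2); first by rewrite invr_gt0 exprn_even_gt0//= kappa_neq0.
    by rewrite !big_ord0 mulr1 addn0 -expr2 mulVf// expf_neq0.
  exists (d / kappa (n + k.+1)%N ^+ 2).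
    by rewrite divr_gt0// exprn_even_gt0//= kappa_neq0.
  rewrite !big_ord_recr /= mulrACA IHk addSn -addnS.
  by have := kappa_neq0 (n + k); have := kappa_neq0 (n + k.+1);
    move: (kappa (n + k)%N) (kappa (n + k.+1)%N) => u v v0 u0; field; rewrite u0 v0.
exists (d * ((a / (1 - a)) ^+ (n + (n + k)) / (n`!%:R * (n + k)`!%:R))).
  by rewrite mulr_gt0// divr_gt0 ?exprn_gt0// mulr_gt0 ?ltr0n ?fact_gt0.
rewrite dE /kappa /dual_factor (exprNn (a / (1 - a)) n) (exprNn (a / (1 - a)) (n + k)).
rewrite [_ ^+ (n + (n + k))]exprD [(-1) ^+ (n + k)]exprD.
have s2 : (-1) ^+ n * (-1) ^+ n = 1 :> R by rewrite -expr2 sqrr_sign.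
have := natr_fact_neq0 R n; have := natr_fact_neq0 R (n + k).
move: ((-1) ^+ n) s2 ((-1) ^+ k) ((a / (1 - a)) ^+ n) ((a / (1 - a)) ^+ (n + k)) => s s2 s' t t'.
move: (n`!%:R) ((n + k)`!%:R) => u v v0 u0.
transitivity (d * ((s * s) * (s' * t * t' * pochhammer c n * pochhammer c (n + k) / (u * v)))).
  by field; rewrite u0 v0.
by rewrite s2; field; rewrite u0 v0.
Qed.

Lemma Omega_mulS n : exists2 d, 0 < d &
  Omega F a c n%:R * Omega F a c n.+1%:R =
  d * ((-1) ^+ kF F * pochhammer c n * pochhammer c (n + kF F) *
       (casorati p (@node R F c) n * casorati p (@node R F c) n.+1)).
Proof.
have [d d0 dE] := prod_kappa (kF F) n.
exists (\prod_i (row_factor n i * row_factor n.+1 i) * d).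
  by rewrite mulr_gt0// prodr_gt0// => i _; exact: row_factor_mul_gt0.
rewrite !Omega_casorati big_split /=.
have rearrange (A B C A' B' C' E X : R) : C * C' = d * E ->
    A * B * C * (A' * B' * C') = A * A' * d * (E * (B * B')).
  move=> CC.
  have -> : A * B * C * (A' * B' * C') = A * A' * (C * C') * (B * B') by ring.
  by rewrite CC; ring.
exact: rearrange.
Qed.

End OmegaSign.

(** * Assembly of the equivalences *)

Section Positivity.
Variables (R : realType) (a c : R) (F : {fset nat} * {fset nat}).
Hypothesis a01 : 0 < a < 1.
Hypothesis hc : forall m : nat, c <> - m%:R.

Let s := pochhammer c (hatc c).
Let P : {poly R} := node_poly (@node R F c).
Let p := meixnerp a c.

Let v y := s * (weight a c y * P.[y%:R]).

Let vE y : v y = a ^+ y / y`!%:R * (sign_weight c y * \prod_i (y%:R - @node R F c i)).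
Proof.
rewrite /v /weight /sign_weight /P horner_prod.
under eq_bigr do rewrite hornerXsubC.
by rewrite -/s; ring.
Qed.

Let v_ge0 y : (0 <= v y) = (0 <= sign_weight c y * \prod_i (y%:R - @node R F c i)).
Proof.
case/andP: a01 => a0 _.
by rewrite vE pmulr_rge0// divr_gt0 ?exprn_gt0// ltr0n fact_gt0.
Qed.

Let v_decay : geometric_decay v.
Proof. exact/geometric_decayZ/weight_polyM_decay. Qed.

Let weight_intE q : s * weight_int a c (P * q ^+ 2) =
  tsum (fun y => v y * q.[y%:R] ^+ 2).
Proof.
rewrite /weight_int -tsumZ; last exact: weight_polyM_decay.
by congr tsum; apply/funext => y; rewrite hornerM horner_exp /v; ring.
Qed.

(** Forward: the nonzero polynomial [P * q] does not vanish at some natural number, whose term is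
    then positive while all others are nonnegative. Backward: [moment_determinacy]. *)
Lemma node_sign_moments :
  (forall n : nat, 0 <= sign_weight c n * \prod_i (n%:R - @node R F c i)) <->
  (forall q : {poly R}, q != 0 -> 0 < s * weight_int a c (P * q ^+ 2)).
Proof.
split=> [pos q q0|pos n]; last first.
  rewrite -v_ge0; apply: moment_determinacy => // q.
  rewrite -weight_intE; have [->|/pos/ltW//] := eqVneq q 0.
  rewrite expr0n mulr0; have := weight_int_linear a01 c 1 0 0.
  by rewrite scale1r addr0 mul1r => h; rewrite (_ : weight_int a c 0 = 0) ?mulr0//; lra.
have Pq0 : P * q != 0 by rewrite mulf_neq0// monic_neq0// node_poly_monic.
have [m Pqm] : exists m : nat, (P * q).[m%:R] != 0.
  apply: contrapT => none; case/negP: Pq0; apply/eqP/poly_eq_nat => m.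
  by rewrite horner0; apply/eqP/negPn/negP => h; apply: none; exists m.
rewrite weight_intE; set w := fun y => _.
have w_ge0 y : 0 <= w y by rewrite mulr_ge0 ?sqr_ge0// v_ge0.
apply: lt_le_trans (tsum_ge_term m (geometric_decay_sq q v_decay) w_ge0).
rewrite lt_neqAle w_ge0 andbT eq_sym.
move: Pqm; rewrite hornerM mulf_eq0 negb_or => /andP[Pm qm].
have /andP[a0 _] := a01.
rewrite !mulf_neq0 ?expf_neq0 ?invr_eq0 ?natr_fact_neq0 ?pochhammer_neq0//.
by rewrite gt_eqF.
Qed.

(** The factor [(c)_(n + k)] comes once from [Gamma] and once from the product of the [Omega], hence
    as a square; the remaining [(c)_n] carries the sign of the norm of [p n]. *)
Lemma Omega_sign n :
  (0 < Gamma (n%:R + c + (kF F)%:R) * Omega F a c n%:R * Omega F a c n.+1%:R) =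
  (0 < s * (-1) ^+ kF F * casorati p (@node R F c) n *
       casorati p (@node R F c) n.+1 * weight_int a c (p n ^+ 2)).
Proof.
have [d1 d1_gt0 d1E] := Gamma_sign (n + kF F) hc.
have [d2 d2_gt0 d2E] := Omega_mulS F a01 hc n.
have [d3 d3_gt0 d3E] := weight_int_meixnerp_sq c a01 n.
have -> : n%:R + c + (kF F)%:R = c + (n + kF F)%:R by rewrite natrD; ring.
rewrite -mulrA d1E d2E d3E -/s -/p.
have := pochhammer_neq0 (n + kF F) hc.
move: (pochhammer c (n + _)) (pochhammer c n) (casorati _ _ _) (casorati _ _ _) ((-1) ^+ _).
move=> u w D' D e u0.
have -> : d1 * (s * u) * (d2 * (e * w * u * (D * D'))) =
  d1 * d2 * u ^+ 2 / d3 * (s * e * D * D' * (d3 * w)) by field; rewrite gt_eqF.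
by rewrite pmulr_rgt0// divr_gt0// (pmulr_rgt0 _ (mulr_gt0 d1_gt0 d2_gt0)) exprn_even_gt0.
Qed.

Lemma moments_casorati :
  (forall q : {poly R}, q != 0 -> 0 < s * weight_int a c (P * q ^+ 2)) <->
  (forall n, 0 < s * (-1) ^+ kF F * casorati p (@node R F c) n *
       casorati p (@node R F c) n.+1 * weight_int a c (p n ^+ 2)).
Proof.
apply: christoffel_positivity.
- exact: weight_int_linear.
- exact: size_meixnerp.
- by move=> n; rewrite lead_coef_meixnerp invr_gt0 ltr0n fact_gt0.
- exact: meixnerp_orth.
- exact: node_inj.
Qed.

End Positivity.

Theorem lemma4p2 (R : realType) (a c : R) (F : {fset nat} * {fset nat})
  (ha : 0 < a < 1)
  (hc : forall m : nat, c <> - m%:R)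
  (hF1 : forall f : nat, f \in F.1 -> (0 < f)%N)
  (hF2 : forall f : nat, f \in F.2 -> (0 < f)%N)
  (hF : ~ (F.1 = fset0 /\ F.2 = fset0)) :
  (positive_discrete (rho F a c) <-> admissible F c) /\
  (admissible F c <->
   forall n : nat,
     0 < Gamma (n%:R + c + (kF F)%:R) * Omega F a c n%:R * Omega F a c n.+1%:R).
Proof.
have a_gt0 : 0 < a by case/andP: ha.
split; first by rewrite positive_rhoP// admissibleP.
rewrite admissibleP//.
apply: (iff_trans (node_sign_moments F ha hc)).
apply: (iff_trans (moments_casorati F ha hc)).
by split=> pos n; have := pos n; rewrite Omega_sign.
Qed.
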